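(* Let $(X,d)$ be a nonempty compact metric space and let $\ell:X\times X\times\mathbb R^2\to\mathbb R$ be continuous and satisfy (l1)–(l4) of the context, with the critical constant of $\ell_0:=\ell(\cdot,\cdot,0,0)$ equal to $0$. Let $\lambda_0>0$ with $\lambda_0\max(\kappa_u,\kappa_v)<1$, and for each $\lambda\in(0,\lambda_0)$ let $u_\lambda\in C^0(X,\mathbb R)$ be a fixed point of $T_\lambda$. Let $\mathcal S_0$ be the set of subsolutions $w$ of $\ell_0$ that satisfy $$\int_{X\times X}\big(\partial_u\ell(z,x,0,0)w(z)+\partial_v\ell(z,x,0,0)w(x)\big)\,d\mu(z,x)\ge0$$ for all Mather measures $\mu$ of $\ell_0$. Then, as $\lambda\to0$, $u_\lambda$ converges uniformly on $X$ to $$u_0:=\sup_{w\in\mathcal S_0}w,$$ where the supremum is taken pointwise. The function $u_0$ is therefore a fixed point of $T_0$.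
   Context: Assumptions on $\ell=\ell(z,x,u,v)$: (l1) $\ell$ is $\kappa_u$-Lipschitz in $u$ and $\kappa_v$-Lipschitz in $v$, for constants $\kappa_u,\kappa_v\ge 0$; (l2) $\ell$ is non-increasing in $u$ and in $v$; (l3) $\partial_u\ell(z,x,0,0)$ and $\partial_v\ell(z,x,0,0)$ exist for all $(z,x)$, and for all $(z,x,u,v)$, $|\ell(z,x,u,v)-\ell(z,x,0,0)-\partial_u\ell(z,x,0,0)u-\partial_v\ell(z,x,0,0)v|\le\frac{|u|+|v|}{2}\,\eta\big(\frac{|u|+|v|}{2}\big)$, where $\eta:[0,\infty)\to[0,\infty)$ is a modulus of continuity (nondecreasing, $\eta(0)=0$, continuous at $0$); (l4) $\int_{X\times X}\big(\partial_u\ell(z,x,0,0)+\partial_v\ell(z,x,0,0)\big)d\mu(z,x)<0$ for all Mather measures $\mu$ of $\ell_0$. $T_0:C^0(X,\mathbb R)\to C^0(X,\mathbb R)$ is $T_0f(x)=\min_{y\in X}\{f(y)+\ell_0(y,x)\}$. There is a unique constant $c_0$ (the critical constant of $\ell_0$) for which there is a continuous $u$ with $u=T_0u+c_0$; here it is assumed that $c_0=0$. A Mather measure of $\ell_0$ is a Borel probability measure $\mu$ on $X\times X$ whose two marginals on $X$ coincide and with $\int_{X\times X}\ell_0\,d\mu=-c_0=0$. A subsolution of $\ell_0$ is a function $w:X\to\mathbb R$ with $w(y)-w(x)\le\ell_0(x,y)$ for all $x,y\in X$. For $\lambda\in(0,\lambda_0)$ and $\varphi\in C^0(X,\mathbb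 R)$, $T_\lambda\varphi\in C^0(X,\mathbb R)$ is the unique continuous function with $T_\lambda\varphi(x)=\min_{z\in X}\{\varphi(z)+\ell(z,x,\lambda\varphi(z),\lambda T_\lambda\varphi(x))\}$ for all $x\in X$. Each $T_\lambda$ has at least one fixed point. *)

(* Defs.v *)
(* MathComp / MathComp-Analysis. *)
From HB Require Import structures.
From mathcomp Require Import all_boot all_order all_algebra.
From mathcomp Require Import all_classical all_reals all_analysis.

Set Implicit Arguments.
Unset Strict Implicit.
Unset Printing Implicit Defensive.

Import Order.TTheory GRing.Theory Num.Theory.
Import numFieldNormedType.Exports.

Local Open Scope classical_set_scope.
Local Open Scope ring_scope.

(* The library's measurable types are pointed, so a nonempty metric space is
   represented as a metric space with a distinguished, otherwise unused, point. *)
#[short(type="pmetricType")]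
HB.structure Definition PointedMetric (K : numDomainType) :=
  {M of Metric K M & Pointed M}.

Notation borel T := (g_sigma_algebraType (@open T)).

Section WeakKAM.
Context {R : realType} {X : pmetricType R}.
Implicit Types (f phi psi w : X -> R) (cost : X -> X -> R)
  (l : X -> X -> R -> R -> R) (ku kv lam : R) (eta : R -> R).

(* Used only for continuous functions on a compact space, where the infimum is
   attained. *)
Definition minimum f : R := inf (range f).

Definition T0 cost f (x : X) : R := minimum (fun y => f y + cost y x).

(* There is exactly one such c when cost is continuous and X is compact. *)
Definition is_critical_constant cost (c : R) : Prop :=
  exists2 u : X -> R, continuous u & forall x, u x = T0 cost u x + c.

Definition has_equal_marginals (mu : probability (borel (X * X)%type) R) : Prop :=
  forall A : set (borel X), measurable A ->
    pushforward mu (fst : borel (X * X)%type -> borel X) A =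
    pushforward mu (snd : borel (X * X)%type -> borel X) A.

(* Mather measures of a cost whose critical constant is 0. *)
Definition is_Mather_measure cost
    (mu : probability (borel (X * X)%type) R) : Prop :=
  has_equal_marginals mu /\ \int[mu]_p cost p.1 p.2 = 0.

Definition is_subsolution cost w : Prop := forall x y, w y - w x <= cost x y.

Definition cost0 l (z x : X) : R := l z x 0 0.

Definition du0 l (z x : X) : R := derive1 (fun u : R => l z x u 0) 0.

Definition dv0 l (z x : X) : R := derive1 (fun v : R => l z x 0 v) 0.

Definition is_Tlambda_image l lam phi psi : Prop :=
  continuous psi /\
  forall x, psi x = minimum (fun z => phi z + l z x (lam * phi z) (lam * psi x)).

(* The operator T_lambda: under the hypotheses of the theorem, for continuous phi
   and lam in ]0, lam0[, there is exactly one psi with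
   [is_Tlambda_image l lam phi psi]. *)
Definition Tlambda l lam phi : X -> R := get (is_Tlambda_image l lam phi).

Definition cond_l1 l ku kv : Prop :=
  [/\ 0 <= ku, 0 <= kv,
      forall z x v, ku.-lipschitz (fun u : R => l z x u v : R) &
      forall z x u, kv.-lipschitz (fun v : R => l z x u v : R)].

Definition cond_l2 l : Prop :=
  (forall z x v, {homo (fun u => l z x u v) : a b /~ a <= b}) /\
  (forall z x u, {homo (fun v => l z x u v) : a b /~ a <= b}).

(* eta represents a function from [0, +oo[ to [0, +oo[: its values at negative
   arguments are irrelevant. *)
Definition is_modulus eta : Prop :=
  [/\ forall r, 0 <= r -> 0 <= eta r,
      forall r s, 0 <= r -> r <= s -> eta r <= eta s,
      eta 0 = 0 &
      eta r @[r --> 0^'+] --> (0 : R)].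

Definition cond_l3 l : Prop :=
  (forall z x, derivable (fun u : R => l z x u 0) 0 1 /\
               derivable (fun v : R => l z x 0 v) 0 1) /\
  exists2 eta, is_modulus eta &
    forall z x u v,
      `|l z x u v - l z x 0 0 - du0 l z x * u - dv0 l z x * v| <=
      (`|u| + `|v|) / 2 * eta ((`|u| + `|v|) / 2).

Definition cond_l4 l : Prop :=
  forall mu, is_Mather_measure (cost0 l) mu ->
    \int[mu]_p (du0 l p.1 p.2 + dv0 l p.1 p.2) < 0.

(* A subsolution need not be Borel. It is however bounded, and coincides with a
   continuous function on a closed set A such that every Mather measure is
   carried by A `*` A; hence the integrand agrees with a bounded Borel function
   off a Borel null set. As [integral] is the difference of the lower integrals
   of the positive and negative parts, it takes on such a function the value of
   the integral for the completed measure. *)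
Definition S0 l : set (X -> R) :=
  [set w | is_subsolution (cost0 l) w /\
    forall mu, is_Mather_measure (cost0 l) mu ->
      0 <= \int[mu]_p (du0 l p.1 p.2 * w p.1 + dv0 l p.1 p.2 * w p.2)].

Definition u0 l (x : X) : R := sup [set w x | w in S0 l].

End WeakKAM.

(* Main.v *)
(* Write c = l(., ., 0, 0), a = - du0 and b = - dv0. A Hahn-Banach and
   Riesz-Markov argument shows that the largest integral of a continuous
   function h against Mather measures is the infimum of the s for which
   h (z, x) <= s + C c z x + g z - g x for some C >= 0 and some continuous g.
   All hypotheses on Mather measures are used through such certificates,
   evaluated on pairs (z, x) that are optimal for u_lam: there
   c z x = u_lam x - u_lam z + lam (a u_lam z + b u_lam x) + o(lam), so that the
   term C c z x is, up to O(lam), a coboundary as well. Applied to (l4) this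
   bounds u_lam uniformly, because a function perturbed by the certificate would
   otherwise decrease strictly from every point; applied to a continuous w in S0
   it gives liminf u_lam >= w, by a maximum principle for w - u_lam.
   Conversely, integrating the inequality for u_lam against a Mather measure
   shows that each limit point of u_lam is in S0. As T0 w dominates w and agrees
   with it almost everywhere for Mather measures, continuous elements of S0
   suffice, so that all limit points are equal to u0. *)
Require Import Defs.
From HB Require Import structures.
From mathcomp Require Import all_boot all_order all_algebra.
From mathcomp Require Import all_classical all_reals all_analysis.
From mathcomp Require Import measurable_realfun ring lra.

Set Implicit Arguments.
Unset Strict Implicit.
Unset Printing Implicit Defensive.

Import Order.TTheory GRing.Theory Num.Theory.
Import numFieldNormedType.Exports.

Local Open Scope classical_set_scope.
Local Open Scope ring_scope.

(** * Linear functionals and Borel measures *)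

(** The multiplier [C] of a certificate is nonnegative because a continuous subsolution forces [c]
    to have nonnegative integral against every probability with equal marginals: the condition that
    this integral vanishes is one-sided. In the asymptotic estimates this sign is what lets the
    upper bound of [c z x] on a pair optimal for [u_lam] be inserted. A certificate holds at every
    pair, so it can be tested at the single pair singled out by a maximum or a minimum; no measure
    is built from the optimal pairs of [u_lam], and no weak limit of measures is taken. Limit points
    are taken along ultrafilters finer than [0^'+], in place of subsequences: all pointwise limits
    then exist at once, and since every such ultrafilter yields the same limit, convergence along
    [0^'+] itself follows. *)

Section HahnBanach.
Context {R : realType} {V : lmodType R}.
Variable S : set V.
Hypothesis SD : forall x y, S x -> S y -> S (x + y).
Hypothesis SZ : forall (a : R) x, S x -> S (a *: x).

(** Relative to the subspace [S] so that continuous functions can be handled inside the module of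
    all functions. Homogeneity is asked as an inequality; equality is recovered in
    [sublinear_onZ]. *)
Definition sublinear_on (q : V -> R) : Prop :=
  (forall x y, S x -> S y -> q (x + y) <= q x + q y) /\
  (forall a x, 0 <= a -> S x -> q (a *: x) <= a * q x).

Definition linear_on (L : V -> R) : Prop :=
  (forall x y, S x -> S y -> L (x + y) = L x + L y) /\
  (forall a x, S x -> L (a *: x) = a * L x).

Let SN x : S x -> S (- x).
Proof. by rewrite -scaleN1r; exact: SZ. Qed.

Lemma sublinear_onN q x : sublinear_on q -> S x -> - q (- x) <= q x.
Proof.
move=> [qD qZ] Sx.
have S0 : S 0 by rewrite -(subrr x); apply: SD => //; exact: SN.
have := qD _ _ Sx (SN Sx); rewrite subrr => h.
have := qD _ _ S0 S0; rewrite addr0 => h0.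
by lra.
Qed.

Lemma sublinear_onZ q a x : sublinear_on q -> 0 <= a -> S x ->
  q (a *: x) = a * q x.
Proof.
move=> hq; have [qD qZ] := hq; rewrite le_eqVlt => /predU1P[<- Sx|a0 Sx].
  have S0 : S 0 by rewrite -(subrr x); apply: SD => //; exact: SN.
  rewrite scale0r mul0r; apply/eqP; rewrite eq_le.
  have := qZ 0 _ (lexx _) Sx; rewrite scale0r mul0r => -> /=.
  by have := qD _ _ S0 S0; rewrite addr0; lra.
apply/eqP; rewrite eq_le qZ ?(ltW a0)//=.
have ai0 : 0 <= a^-1 by rewrite invr_ge0 ltW.
have := qZ _ _ ai0 (SZ a Sx); rewrite scalerA mulVf ?gt_eqF// scale1r => h.
by rewrite -ler_pdivlMl.
Qed.

(** The device that makes a minimal sublinear functional linear: the tilt is again sublinear, lies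
    below [q] (take [t = 0]), and is at most [q (f + g) - q g] (take [t = 1]). If [q] is minimal,
    this gives [q f + q g <= q (f + g)]. *)
Definition tilt (q : V -> R) (g f : V) : R :=
  inf [set q (f + t *: g) - t * q g | t in [set t : R | 0 <= t]].

Lemma tilt_lb q g f t : sublinear_on q -> S g -> S f -> 0 <= t ->
  - q (- f) <= q (f + t *: g) - t * q g.
Proof.
move=> hq Sg Sf t0; have [qD _] := hq.
have := qD _ _ (SD Sf (SZ t Sg)) (SN Sf).
by rewrite addrAC subrr add0r (sublinear_onZ hq t0 Sg); lra.
Qed.

Lemma tilt_le q g f t : sublinear_on q -> S g -> S f -> 0 <= t ->
  tilt q g f <= q (f + t *: g) - t * q g.
Proof.
move=> hq Sg Sf t0; apply: ge_inf; last by exists t.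
by exists (- q (- f)) => _ [s /= s0 <-]; exact: tilt_lb.
Qed.

Lemma tilt_ge q g f r :
  (forall t, 0 <= t -> r <= q (f + t *: g) - t * q g) -> r <= tilt q g f.
Proof.
move=> h; apply: lb_le_inf; last by move=> _ [t /= t0 <-]; exact: h.
by exists (q (f + 0 *: g) - 0 * q g); exists 0 => //=.
Qed.

Lemma sublinear_tilt q g : sublinear_on q -> S g -> sublinear_on (tilt q g).
Proof.
move=> hq Sg; have [qD qZ] := hq; split=> [x y Sx Sy|a x a0 Sx].
  rewrite -lerBlDr; apply: tilt_ge => t t0; rewrite lerBlDr -lerBlDl.
  apply: tilt_ge => s s0; rewrite lerBlDl.
  apply: (le_trans (tilt_le hq Sg (SD Sx Sy) (addr_ge0 t0 s0))).
  have := qD _ _ (SD Sx (SZ t Sg)) (SD Sy (SZ s Sg)).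
  by rewrite addrACA -scalerDl; lra.
have [->|an0] := eqVneq a 0.
  rewrite scale0r mul0r.
  have S0 : S 0 by rewrite -(subrr g); apply: SD => //; exact: SN.
  apply: (le_trans (tilt_le hq Sg S0 (lexx 0))).
  by rewrite scale0r mul0r addr0 subr0 -(scale0r g) sublinear_onZ// mul0r.
have a_gt0 : 0 < a by rewrite lt_neqAle eq_sym an0.
rewrite -ler_pdivrMl//; apply: tilt_ge => t t0; rewrite ler_pdivrMl//.
have := tilt_le hq Sg (SZ a Sx) (mulr_ge0 a0 t0).
move=> /le_trans; apply.
by have := qZ a _ a0 (SD Sx (SZ t Sg)); rewrite scalerDr scalerA; lra.
Qed.

Lemma sublinear_minimal p : sublinear_on p ->
  exists2 q, sublinear_on q /\ (forall x, S x -> q x <= p x) &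
    forall q', sublinear_on q' -> (forall x, S x -> q' x <= q x) ->
      forall x, S x -> q x <= q' x.
Proof.
move=> hp.
pose T := {q : V -> R | sublinear_on q /\ forall x, S x -> q x <= p x}.
pose leT (q1 q2 : {classic T}) :=
  `[< forall x, S x -> sval q2 x <= sval q1 x >].
have t0 : {classic T} by exists p; split.
have [| | |q qmin] := @ZL_preorder {classic T} t0 leT.
- by move=> t; apply/asboolP.
- move=> q1 q2 q3 /asboolP h12 /asboolP h23; apply/asboolP => x Sx.
  exact: le_trans (h23 _ Sx) (h12 _ Sx).
- move=> A Atot; have [[q0 Aq0]|A0] := pselect (A !=set0); last first.
    by exists t0 => s As; exfalso; apply: A0; exists s.
  (* The infimum over a chain is finite, since all members lie above [- p (- x)], and subadditive,
     since the smaller of two members can serve at both points. *)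
  pose m x := inf [set sval (q : {classic T}) x | q in A].
  have mle x q : S x -> A q -> m x <= sval q x.
    move=> Sx Aq; apply: ge_inf; last by exists q.
    exists (- p (- x)) => _ [s As <-]; have [hs sp] := svalP s.
    apply: le_trans (sublinear_onN hs Sx); rewrite lerN2.
    by apply: sp; exact: SN.
  have mge x r : (forall q, A q -> r <= sval q x) -> r <= m x.
    move=> h; apply: lb_le_inf; first by exists (sval q0 x), q0.
    by move=> _ [q Aq <-]; exact: h.
  have hm : sublinear_on m.
    split=> [x y Sx Sy|a x a0 Sx].
      rewrite -lerBlDr; apply: (mge) => q1 Aq1; rewrite lerBlDr -lerBlDl.
      apply: (mge) => q2 Aq2; rewrite lerBlDl.
      have [/asboolP h|/asboolP h] := Atot _ _ Aq1 Aq2.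
        apply: (le_trans (mle _ _ (SD Sx Sy) Aq2)).
        have [[qD _] _] := svalP q2; have := qD _ _ Sx Sy.
        by have := h _ Sx; lra.
      apply: (le_trans (mle _ _ (SD Sx Sy) Aq1)).
      have [[qD _] _] := svalP q1; have := qD _ _ Sx Sy.
      by have := h _ Sy; lra.
    have [->|an0] := eqVneq a 0.
      have [[qD qZ] _] := svalP q0.
      apply: (le_trans (mle _ _ (SZ 0 Sx) Aq0)).
      by apply: (le_trans (qZ _ _ (lexx 0) Sx)); rewrite !mul0r.
    have a_gt0 : 0 < a by rewrite lt_neqAle eq_sym an0.
    rewrite -ler_pdivrMl//; apply: (mge) => q Aq; rewrite ler_pdivrMl//.
    apply: (le_trans (mle _ _ (SZ a Sx) Aq)).
    by have [[_ qZ] _] := svalP q; exact: qZ.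
  have mp x : S x -> m x <= p x.
    move=> Sx; apply: (le_trans (mle _ _ Sx Aq0)).
    by have [_] := svalP q0; exact.
  exists (exist _ m (conj hm mp) : {classic T}) => q Aq.
  by apply/asboolP => x Sx /=; exact: mle.
have [hq qp] := svalP q; exists (sval q) => // q' hq' q'q x Sx.
have q'p y : S y -> q' y <= p y.
  by move=> Sy; exact: le_trans (q'q _ Sy) (qp _ Sy).
have /qmin/asboolP : leT q (exist _ q' (conj hq' q'p)) by apply/asboolP.
exact.
Qed.

(** The minimal functional is taken below [tilt p h] instead of below [p]: at [- h], with [t = 1],
    the tilt is at most [p 0 - p h], whence [- L h <= - p h]. *)
Lemma Hahn_Banach p h : sublinear_on p -> S h ->
  exists L, [/\ linear_on L, forall x, S x -> L x <= p x & p h <= L h].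
Proof.
move=> hp Sh.
have [L [hL Lp] Lmin] := sublinear_minimal (sublinear_tilt hp Sh).
have L_additive f g : S f -> S g -> L f + L g <= L (f + g).
  move=> Sf Sg.
  have tilt_leL x : S x -> tilt L g x <= L x.
    move=> Sx; have := tilt_le hL Sg Sx (lexx 0).
    by rewrite scale0r mul0r addr0 subr0.
  have := Lmin _ (sublinear_tilt hL Sg) tilt_leL _ Sf.
  by have := tilt_le hL Sg Sf ler01; rewrite scale1r mul1r; lra.
have LD f g : S f -> S g -> L (f + g) = L f + L g.
  move=> Sf Sg; apply/eqP; rewrite eq_le L_additive// andbT.
  by have [qD _] := hL; exact: qD.
have S0 : S 0 by rewrite -(scale0r h); exact: SZ.
have L0 : L 0 = 0 by have := LD _ _ S0 S0; rewrite addr0; lra.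
have LN x : S x -> L (- x) = - L x.
  by move=> Sx; have := LD _ _ Sx (SN Sx); rewrite subrr L0; lra.
exists L; split.
- split=> // a x Sx; have [a0|a0] := leP 0 a; first exact: sublinear_onZ.
  rewrite -[a]opprK scaleNr LN; last exact: SZ.
  by rewrite (sublinear_onZ hL) ?mulNr// oppr_ge0 ltW.
- move=> x Sx; apply: (le_trans (Lp _ Sx)).
  by have := tilt_le hp Sh Sx (lexx 0); rewrite scale0r mul0r addr0 subr0.
- have := Lp _ (SN Sh); have := tilt_le hp Sh (SN Sh) ler01.
  rewrite scale1r mul1r addNr LN// -(scale0r h) sublinear_onZ// mul0r.
  by lra.
Qed.

End HahnBanach.

Lemma cont_cst {S T : topologicalType} (t : T) : continuous (fun _ : S => t).
Proof. by move=> s; exact: cvg_cst. Qed.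

Lemma cont_pair {S T U : topologicalType} (f : S -> T) (g : S -> U) :
  continuous f -> continuous g -> continuous (fun s => (f s, g s)).
Proof. by move=> cf cg s; apply: cvg_pair => /=; [exact: cf|exact: cg]. Qed.

Lemma cont_comp {S T U : topologicalType} (f : S -> T) (g : T -> U) :
  continuous f -> continuous g -> continuous (fun s => g (f s)).
Proof. by move=> cf cg s; apply: continuous_comp; [exact: cf|exact: cg]. Qed.

Lemma cont_id {S : topologicalType} : continuous (fun s : S => s).
Proof. by move=> s; exact: cvg_id. Qed.

Lemma cont_fst {S T : topologicalType} : continuous (@fst S T).
Proof. by move=> s; exact: cvg_fst. Qed.

Lemma cont_snd {S T : topologicalType} : continuous (@snd S T).
Proof. by move=> s; exact: cvg_snd. Qed.

Section ContinuousReal.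
Context {R : realType} {T : topologicalType}.
Implicit Types f g : T -> R.

Lemma contD f g : continuous f -> continuous g ->
  continuous (fun y => f y + g y).
Proof. by move=> cf cg y; apply: cvgD; [exact: cf|exact: cg]. Qed.

Lemma contN f : continuous f -> continuous (fun y => - f y).
Proof. by move=> cf y; apply: cvgN; exact: cf. Qed.

Lemma contB f g : continuous f -> continuous g ->
  continuous (fun y => f y - g y).
Proof. by move=> cf cg; apply: contD => //; exact: contN. Qed.

Lemma contM f g : continuous f -> continuous g ->
  continuous (fun y => f y * g y).
Proof. by move=> cf cg y; apply: cvgM; [exact: cf|exact: cg]. Qed.

Lemma contZ (a : R) f : continuous f -> continuous (fun y => a * f y).
Proof. by move=> cf; apply: contM => //; exact: cont_cst. Qed.

Lemma cont_norm f : continuous f -> continuous (fun y => `|f y|).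
Proof. by move=> cf y; apply: cvg_norm; exact: cf. Qed.

Lemma cont_min f g : continuous f -> continuous g ->
  continuous (fun y => Num.min (f y) (g y)).
Proof. by move=> cf cg y; apply: continuous_min; [exact: cf|exact: cg]. Qed.

Lemma cont_sum (n : nat) (h : nat -> T -> R) : (forall i, continuous (h i)) ->
  continuous (fun y => \sum_(0 <= i < n) h i y).
Proof.
move=> ch; elim: n => [|n IH].
  by under eq_fun do rewrite big_geq//; exact: cont_cst.
under eq_fun do rewrite big_nat_recr//=.
exact: contD.
Qed.

Lemma continuousP_lt f : continuous f <->
  forall y e, 0 < e -> \forall z \near y, `|f z - f y| < e.
Proof.
split=> [cf y e e0|h y].
  by have /cvgrPdistC_lt := cf y; exact.
by apply/cvgrPdistC_lt => e e0; exact: h.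
Qed.

Hypothesis compactT : compact [set: T].

Lemma compact_max (y0 : T) f : continuous f -> exists c, forall y, f y <= f c.
Proof.
move=> cf; have cf' : {within setT, continuous f}.
  by apply: continuous_subspaceT => x; exact: cf.
have [|c _ cP] := compact_EVT_max _ compactT cf'; first by exists y0.
by exists c => y; apply: cP; rewrite inE.
Qed.

Lemma compact_min (y0 : T) f : continuous f -> exists c, forall y, f c <= f y.
Proof.
move=> cf; have [c cP] := compact_max y0 (contN cf).
by exists c => y; rewrite -lerN2.
Qed.

End ContinuousReal.

(** The witness is the distance to the complement of [U], truncated at 1 and written with balls. The
    truncation keeps [E y] nonempty when [U] is the whole space. *)
Lemma open_cozero {R : realType} {T : pseudoMetricType R} (U : set T) :
  open U ->
  exists f : T -> R,
    [/\ continuous f, forall y, 0 <= f y & forall y, U y <-> 0 < f y].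
Proof.
move=> oU.
pose E y := [set e : R | 0 < e /\ (e = 1 \/ exists2 z, ~ U z & ball y e z)].
have E1 y : E y 1 by split; [|left].
have El y : lbound (E y) 0 by move=> e [/ltW].
have hE y : has_lbound (E y) by exists 0.
exists (fun y => inf (E y)); split.
- have key y z e : 0 < e -> ball y e z -> inf (E y) <= inf (E z) + e.
    move=> e0 yz; rewrite -lerBlDr; apply: lb_le_inf; first by exists 1.
    move=> d [d0 [->|[t Ut zt]]].
      by rewrite lerBlDr (le_trans (ge_inf (hE y) (E1 y)))// lerDl ltW.
    rewrite lerBlDr; apply: (ge_inf (hE y)); split; first exact: addr_gt0.
    by right; exists t => //; rewrite addrC; exact: (ball_triangle yz zt).
  apply/continuousP_lt => y e e0; near=> z.
  have yz : ball y (e / 2) z.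
    by near: z; exact: (nbhsx_ballx _ _ (divr_gt0 e0 (ltr0n _ 2))).
  have e20 : 0 < e / 2 by rewrite divr_gt0.
  have := key _ _ _ e20 yz; have := key _ _ _ e20 (ball_sym yz).
  by rewrite ltr_norml; lra.
- by move=> y; apply: lb_le_inf => //; exists 1.
- move=> y; split=> [Uy|].
    have /nbhs_ballP[e /= e0 eU] := open_nbhs_nbhs (conj oU Uy).
    apply: (@lt_le_trans _ _ (Num.min 1 e)); first by rewrite lt_min ltr01.
    apply: lb_le_inf; first by exists 1.
    move=> d [d0 [->|[t Ut yt]]]; first by rewrite ge_min lexx.
    rewrite ge_min; apply/orP; right; rewrite leNgt; apply/negP => de.
    by apply: Ut; apply: eU; exact: le_ball (ltW de) _ yt.
  move=> h; apply: contrapT => nU; have h2 := divr_gt0 h (ltr0n _ 2).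
  have : inf (E y) <= inf (E y) / 2.
    apply: (ge_inf (hE y)); split=> //; right.
    by exists y => //; exact: ballxx.
  by lra.
Unshelve. all: by end_near. Qed.

Section BorelIntegral.
Context {R : realType} {T : ptopologicalType}.
Hypothesis compactT : compact [set: T].
Variable mu : probability (borel T) R.

Lemma cont_measurable (f : T -> R) : continuous f ->
  measurable_fun [set: borel T] (f : borel T -> R).
Proof.
move=> cf; apply: (measurability _ (RGenOpens.measurableE R)).
move=> _ [_ [a [b ->]] <-]; rewrite setTI; apply: sub_sigma_algebra.
by apply: open_comp; [move=> y _; exact: cf|exact: interval_open].
Qed.

Lemma cont_integrable (f : T -> R) : continuous f ->
  mu.-integrable [set: borel T] (EFin \o (f : borel T -> R)).
Proof.
move=> cf; have [c fc] := compact_max compactT point (cont_norm cf).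
apply: (@le_integrable _ _ _ _ _ _ _ (EFin \o cst `|f c|)) => //.
- by apply/measurable_EFinP; exact: cont_measurable.
- by move=> y _ /=; rewrite lee_fin normr_id.
- exact: finite_measure_integrable_cst.
Qed.

Lemma intD (f g : T -> R) : continuous f -> continuous g ->
  \int[mu]_y (f y + g y) = \int[mu]_y f y + \int[mu]_y g y.
Proof. by move=> cf cg; apply: RintegralD => //; exact: cont_integrable. Qed.

Lemma intB (f g : T -> R) : continuous f -> continuous g ->
  \int[mu]_y (f y - g y) = \int[mu]_y f y - \int[mu]_y g y.
Proof. by move=> cf cg; apply: RintegralB => //; exact: cont_integrable. Qed.

Lemma intZ a (f : T -> R) : continuous f ->
  \int[mu]_y (a * f y) = a * \int[mu]_y f y.
Proof. by move=> cf; apply: RintegralZl => //; exact: cont_integrable. Qed.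

Lemma int_cst (a : R) : \int[mu]_y a = a.
Proof.
have muT : mu setT = 1%E by exact: probability_setT.
by rewrite Rintegral_cst//= muT mulr1.
Qed.

Lemma le_int (f g : T -> R) : continuous f -> continuous g ->
  (forall y, f y <= g y) -> \int[mu]_y f y <= \int[mu]_y g y.
Proof.
move=> cf cg fg; apply: le_Rintegral => //; try exact: cont_integrable.
Qed.

Lemma int_indic_le (f : T -> R) (A : set (borel T)) a : continuous f ->
  measurable A -> (forall y, f y <= a * \1_A y) ->
  \int[mu]_y f y <= a * fine (mu A).
Proof.
move=> cf mA fA; have iA := integrable_indic mu mA.
have -> : fine (mu A) = \int[mu]_y \1_A y.
  by rewrite /Rintegral integral_indic// setIT.
rewrite -RintegralZl//; apply: le_Rintegral => //; first exact: cont_integrable.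
exact: (integrableZl measurableT a iA).
Qed.

Lemma cont_gt_measurable (f : T -> R) a : continuous f ->
  measurable ([set y | a < f y] : set (borel T)).
Proof.
move=> cf; apply: sub_sigma_algebra.
rewrite (_ : [set _ | _] = f @^-1` [set x | a < x])//.
by apply: open_comp; [move=> y _; exact: cf|exact: open_gt].
Qed.

End BorelIntegral.

(** * Riesz-Markov representation through an outer measure *)

Section RieszMarkov.
Context {R : realType} {T : ptopologicalType}.
Hypothesis compactT : compact [set: T].
Hypothesis cozeroT : forall U : set T, open U ->
  exists f : T -> R,
    [/\ continuous f, forall y, 0 <= f y & forall y, U y <-> 0 < f y].
Variable L : (T -> R) -> R.
Hypothesis LD : forall f g : T -> R, continuous f -> continuous g ->
  L (fun y => f y + g y) = L f + L g.
Hypothesis LZ : forall (a : R) (f : T -> R), continuous f ->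
  L (fun y => a * f y) = a * L f.
Hypothesis L_ge0 : forall f : T -> R, continuous f ->
  (forall y, 0 <= f y) -> 0 <= L f.
Hypothesis L1 : L (fun=> 1) = 1.

Lemma posfunB (f g : T -> R) : continuous f -> continuous g ->
  L (fun y => f y - g y) = L f - L g.
Proof.
move=> cf cg; rewrite (LD cf (contN cg)); congr (_ + _).
by under eq_fun do rewrite -mulN1r; rewrite LZ// mulN1r.
Qed.

Lemma le_posfun (f g : T -> R) : continuous f -> continuous g ->
  (forall y, f y <= g y) -> L f <= L g.
Proof.
move=> cf cg fg; rewrite -subr_ge0 -posfunB//; apply: L_ge0.
  exact: contB.
by move=> y; rewrite subr_ge0.
Qed.

Lemma posfun_cst a : L (fun=> a) = a.
Proof. by have := LZ a (@cont_cst T R 1); rewrite L1 mulr1. Qed.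

Lemma posfun_sum n (h : nat -> T -> R) : (forall i, continuous (h i)) ->
  L (fun y => \sum_(0 <= i < n) h i y) = \sum_(0 <= i < n) L (h i).
Proof.
move=> ch; elim: n => [|n IH].
  under eq_fun do rewrite big_geq//.
  by rewrite big_geq// posfun_cst.
under eq_fun do rewrite big_nat_recr//=.
by rewrite big_nat_recr//= LD// ?IH//; exact: cont_sum.
Qed.

(* The value of a cover is a bound on the functional along an increasing
   sequence, rather than a sum: countable unions then need no double series. *)
Definition covers (A : set T) (f : nat -> T -> R) (s : R) : Prop :=
  [/\ forall n, continuous (f n), forall n y, 0 <= f n y,
      forall m n y, (m <= n)%N -> f m y <= f n y,
      forall n, L (f n) <= s &
      forall y, A y -> forall e, 0 < e -> exists n, 1 - e < f n y].

Definition outer_value (A : set T) : R := inf [set s | exists f, covers A f s].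

Lemma covers_cst A (f : T -> R) : continuous f -> (forall y, 0 <= f y) ->
  (forall y, A y -> 1 <= f y) -> covers A (fun=> f) (L f).
Proof.
move=> cf f0 f1; split=> // y Ay e e0; exists 0%N.
by apply: lt_le_trans (f1 _ Ay); rewrite ltrBlDr ltrDl.
Qed.

Lemma covers1 A : covers A (fun=> fun=> 1) 1.
Proof.
by have := @covers_cst A (fun=> 1) (@cont_cst T R 1); rewrite L1; exact.
Qed.

Lemma covers_ge0 A f s : covers A f s -> 0 <= s.
Proof. by case=> cf f0 _ fs _; apply: le_trans (fs 0%N); exact: L_ge0. Qed.

Lemma covers_sub A B f s : A `<=` B -> covers B f s -> covers A f s.
Proof. by move=> AB [cf f0 fm fs fc]; split=> // y /AB; exact: fc. Qed.

Lemma outer_value_le A f s : covers A f s -> outer_value A <= s.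
Proof.
move=> h; apply: ge_inf; last by exists f.
by exists 0 => r [g]; exact: covers_ge0.
Qed.

Lemma outer_value_ge A r : (forall f s, covers A f s -> r <= s) ->
  r <= outer_value A.
Proof.
move=> h; apply: lb_le_inf; first by exists 1, (fun=> fun=> 1); exact: covers1.
by move=> s [f]; exact: h.
Qed.

Lemma outer_value_adherent A e : 0 < e ->
  exists f s, covers A f s /\ s <= outer_value A + e.
Proof.
move=> e0; have [|s [f fs] sA] :=
    @inf_adherent R [set s | exists f, covers A f s] e e0.
  split; first by exists 1, (fun=> fun=> 1); exact: covers1.
  by exists 0 => r [g]; exact: covers_ge0.
by exists f, s; split=> //; exact: ltW.
Qed.

Definition outer_of (A : set T) : \bar R := (outer_value A)%:E.

Lemma outer_of0 : outer_of set0 = 0%E.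
Proof.
congr EFin; apply/eqP; rewrite eq_le; apply/andP; split; last first.
  by apply: outer_value_ge => f s; exact: covers_ge0.
rewrite -[leRHS](posfun_cst 0); apply: (@outer_value_le _ (fun=> fun=> 0)).
by apply: covers_cst => //; exact: cont_cst.
Qed.

Lemma outer_value_ge0 A : 0 <= outer_value A.
Proof. by apply: outer_value_ge => f s; exact: covers_ge0. Qed.

Lemma outer_of_ge0 A : (0 <= outer_of A)%E.
Proof. by rewrite lee_fin outer_value_ge0. Qed.

Lemma le_outer_value A B : A `<=` B -> outer_value A <= outer_value B.
Proof.
move=> AB; apply: outer_value_ge => f s /(covers_sub AB).
exact: outer_value_le.
Qed.

Lemma le_outer_of : {homo outer_of : A B / A `<=` B >-> (A <= B)%E}.
Proof. by move=> A B AB; rewrite lee_fin le_outer_value. Qed.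

Lemma outer_of_sigma_subadditive : sigma_subadditive outer_of.
Proof.
move=> F; apply/lee_addgt0Pr => e e0.
apply: le_trans (epsilon_trick xpredT _ (ltW e0)); last first.
  by move=> n; exact: outer_of_ge0.
have ei i : 0 < e / (2 ^ i.+1)%:R :> R.
  by rewrite divr_gt0// ltr0n expn_gt0.
have [G GP] := choice (fun i => outer_value_adherent (F i) (ei i)).
have [s sP] := choice GP.
set S := (\sum_(0 <= i <oo) _)%E.
have S_ge n : ((\sum_(0 <= i < n) s i)%:E <= S)%E.
  apply: le_trans (nneseries_lim_ge n _); last first.
    by move=> i _ _; rewrite adde_ge0 ?outer_of_ge0// lee_fin ltW.
  rewrite -sumEFin; apply: lee_sum => i _.
  by rewrite -EFinD lee_fin; case: (sP i).
have [cG G0 Gm Gs Gc] : [/\ forall i n, continuous (G i n),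
    forall i n y, 0 <= G i n y,
    forall i m n y, (m <= n)%N -> G i m y <= G i n y,
    forall i n, L (G i n) <= s i &
    forall i y, F i y -> forall e, 0 < e -> exists n, 1 - e < G i n y].
  by split=> i; have [[]] := sP i.
case: S S_ge => [r| |] S_ge; [|by rewrite leey|]; last first.
  by have := S_ge 0%N; rewrite leeNy_eq.
rewrite lee_fin.
(* A diagonal cover: the first [n] sequences, each at its stage [n]. It increases with [n], its
   values under [L] stay below the partial sums of [s], and a point of [F i] is served once [n]
   exceeds [i] and the stage is late enough. *)
apply: (@outer_value_le _ (fun n y => \sum_(0 <= i < n) G i n y)); split.
- by move=> n; apply: cont_sum.
- by move=> n y; apply: sumr_ge0.
- move=> m n y mn; rewrite (big_cat_nat (leq0n m) mn)//=.
  apply: (@le_trans _ _ (\sum_(0 <= i < m) G i n y)).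
    by apply: ler_sum => i _; exact: Gm.
  by rewrite lerDl; apply: sumr_ge0.
- move=> n; rewrite posfun_sum// -lee_fin; apply: le_trans (S_ge n).
  by rewrite lee_fin; apply: ler_sum => i _.
- move=> y [i _ Fiy] d d0; have [n dn] := Gc _ _ Fiy _ d0.
  exists (maxn n i.+1).
  have iN : (i < maxn n i.+1)%N by rewrite leq_max ltnSn orbT.
  rewrite (lt_le_trans dn)// (big_cat_nat (leq0n i.+1) iN)//= big_nat_recr//=.
  apply: (le_trans (Gm i _ _ y (leq_maxl n i.+1))).
  by rewrite -addrA addrCA lerDl addr_ge0// sumr_ge0.
Qed.

HB.instance Definition _ := isOuterMeasure.Build R T outer_of
  outer_of0 outer_of_ge0 le_outer_of outer_of_sigma_subadditive.

(** The functions [phi n] increase to the indicator of [U]. A cover [g] of [A] is split by one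
    [phi k] with [l - e < L (phi k)]: outside [U], where [phi k] vanishes, [g n * (1 - phi k)] is a
    cover; inside [U], [g n * phi k] becomes one after adding [phi (n + k) - phi k], which costs at
    most [l - L (phi k) < e]. *)
Lemma open_caratheodory (U : set T) : open U -> outer_of.-caratheodory U.
Proof.
move=> /cozeroT[f [cf f0 fU]].
apply: le_caratheodory_measurable => A; rewrite -EFinD lee_fin.
pose phi n y := Num.min 1 (n%:R * f y).
have cphi n : continuous (phi n).
  by apply: cont_min; [exact: cont_cst|exact: contZ].
have phi0 n y : 0 <= phi n y by rewrite le_min ler01 mulr_ge0.
have phi1 n y : phi n y <= 1 by rewrite ge_min lexx.
have phim m n y : (m <= n)%N -> phi m y <= phi n y.
  move=> mn; rewrite le_min phi1/= ge_min; apply/orP; right.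
  by rewrite ler_wpM2r// ler_nat.
have phiC n y : ~ U y -> phi n y = 0.
  move=> nU; have fy0 : f y = 0.
    apply/eqP; rewrite eq_le f0 andbT leNgt; apply/negP => /fU.
    exact: nU.
  by rewrite /phi fy0 mulr0 min_r// ler01.
have phiU y : U y -> exists n, phi n y = 1.
  move=> /fU fy; exists (Num.truncn (f y)^-1).+1; rewrite /phi min_l//.
  by rewrite -ler_pdivrMr// mul1r ltW// truncnS_gt.
pose l := sup [set L (phi n) | n in [set: nat]].
have hl : has_sup [set L (phi n) | n in [set: nat]].
  split; first by exists (L (phi 0%N)), 0%N.
  exists 1 => _ [n _ <-]; rewrite -L1; apply: le_posfun => //.
  exact: cont_cst.
have Ll n : L (phi n) <= l by apply: sup_upper_bound => //; exists n.
apply: outer_value_ge => g s [cg g0 gm gs gc].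
apply/ler_addgt0Pr => e e0.
have [_ [k _ <-]] := sup_adherent e0 hl; rewrite -/l => lk.
have cgphi n : continuous (fun y => g n y * phi k y) by exact: contM.
have cgpsi n : continuous (fun y => g n y * (1 - phi k y)).
  by apply: contM => //; apply: contB => //; exact: cont_cst.
have psi0 y : 0 <= 1 - phi k y by rewrite subr_ge0.
pose s1 := sup [set L (fun y => g n y * phi k y) | n in [set: nat]].
have split_le m n :
    L (fun y => g m y * phi k y) + L (fun y => g n y * (1 - phi k y)) <= s.
  rewrite -LD//; apply: le_trans (gs (maxn m n)).
  apply: le_posfun => //; first exact: contD.
  move=> y; have := ler_wpM2r (phi0 k y) (gm _ _ y (leq_maxl m n)).
  by have := ler_wpM2r (psi0 y) (gm _ _ y (leq_maxr m n)); lra.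
have hs1 : has_sup [set L (fun y => g n y * phi k y) | n in [set: nat]].
  split; first by exists (L (fun y => g 0%N y * phi k y)), 0%N.
  exists s => _ [n _ <-]; apply: le_trans (split_le n n).
  by rewrite lerDl; apply: L_ge0 => // y; rewrite mulr_ge0.
have out_le : outer_value (A `&` ~` U) <= s - s1.
  apply: (@outer_value_le _ (fun n y => g n y * (1 - phi k y))); split=> //.
  - by move=> n y; rewrite mulr_ge0.
  - by move=> m n y mn; rewrite ler_wpM2r// gm.
  - move=> n; rewrite lerBrDr -lerBrDl; apply: ge_sup.
      by exists (L (fun y => g 0%N y * phi k y)), 0%N.
    by move=> _ [m _ <-]; rewrite lerBrDl addrC.
  - move=> y [Ay nUy] d d0; have [n dn] := gc y Ay d d0; exists n.
    by rewrite phiC// subr0 mulr1.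
have in_le : outer_value (A `&` U) <= s1 + (l - L (phi k)).
  apply: (@outer_value_le _ (fun n y => g n y * phi k y
    + (phi (n + k)%N y - phi k y))); split.
  - by move=> n; apply: contD => //; exact: contB.
  - move=> n y; rewrite addr_ge0 ?mulr_ge0// subr_ge0 phim//.
    exact: leq_addl.
  - move=> m n y mn; apply: lerD; first by rewrite ler_wpM2r// gm.
    by rewrite lerD2r phim// leq_add2r.
  - move=> n; rewrite LD//; last exact: contB.
    rewrite posfunB//; apply: lerD; last by rewrite lerD2r.
    by apply: sup_upper_bound => //; exists n.
  - move=> y [Ay Uy] d d0; have [n dn] := gc y Ay _ (divr_gt0 d0 (ltr0n _ 2)).
    have [m pm] := phiU y Uy; exists (maxn n m).
    have -> : phi (maxn n m + k)%N y = 1.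
      apply/eqP; rewrite eq_le phi1/= -pm phim//.
      by rewrite (leq_trans (leq_maxr n m))// leq_addr.
    have gn := lt_le_trans dn (gm _ _ y (leq_maxl n m)).
    have := ler_wpM2r (phi0 k y) (ltW gn).
    by have := mulr_ge0 (ltW d0) (psi0 y); lra.
by lra.
Qed.

Lemma borel_caratheodory (A : set (borel T)) : measurable A ->
  outer_of.-caratheodory A.
Proof.
apply: smallest_sub; last by move=> U; exact: open_caratheodory.
split; first exact: caratheodory_measurable_set0.
  by move=> B hB; rewrite setTD; exact: caratheodory_measurable_setC.
by move=> F hF; exact: caratheodory_measurable_bigcup.
Qed.

Definition riesz_measure (A : set (borel T)) : \bar R := outer_of A.

Lemma riesz_measure0 : riesz_measure set0 = 0%E.
Proof. exact: outer_of0. Qed.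

Lemma riesz_measure_ge0 A : (0 <= riesz_measure A)%E.
Proof. exact: outer_of_ge0. Qed.

Lemma riesz_measure_sigma_additive : semi_sigma_additive riesz_measure.
Proof.
move=> F mF tF mUF.
apply: (@caratheodory_measure_sigma_additive R T outer_of) => //.
- by move=> i; exact: borel_caratheodory.
- exact: borel_caratheodory.
Qed.

HB.instance Definition _ := isMeasure.Build _ (borel T) R riesz_measure
  riesz_measure0 riesz_measure_ge0 riesz_measure_sigma_additive.

Lemma riesz_measureT : riesz_measure setT = 1%E.
Proof.
congr EFin; apply/eqP; rewrite eq_le; apply/andP; split.
  by apply: outer_value_le; exact: covers1.
apply: outer_value_ge => f s [cf f0 fm fs fc].
apply/ler_addgt0Pr => e e0.
(* Dini's argument: monotonicity in [n] and compactness give one stage at which the cover exceeds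
   [1 - e] at every point. *)
have /compact_near_coveringP/(_ nat \oo (fun n y => 1 - e < f n y)) := compactT.
case=> [x _|N _ /(_ N (leqnn _)) hN].
  have [n hn] := fc x I e e0.
  near=> z i => /=; apply: (@lt_le_trans _ _ (f n z)).
    near: z; have /continuousP_lt/(_ x (f n x - (1 - e))) := cf n.
    rewrite subr_gt0 => /(_ hn); apply: filterS => z.
    by rewrite ltr_norml; lra.
  by apply: fm; near: i; exact: nbhs_infty_ge.
have : L (fun=> 1 - e) <= L (f N).
  by apply: le_posfun => [||y]; [exact: cont_cst|exact: cf|exact/ltW/hN].
by rewrite posfun_cst; have := fs N; lra.
Unshelve. all: by end_near. Qed.

HB.instance Definition _ := Measure_isProbability.Build _ _ _ riesz_measure
  riesz_measureT.

Lemma outer_value_gt_le (f : T -> R) a : continuous f -> (forall y, 0 <= f y) ->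
  0 < a -> a * outer_value [set y | a <= f y] <= L f.
Proof.
move=> cf f0 a0; rewrite -ler_pdivlMl// -LZ//.
apply: outer_value_le; apply: covers_cst; first exact: contZ.
- by move=> y; rewrite mulr_ge0// invr_ge0 ltW.
- by move=> y /= ay; rewrite ler_pdivlMl// mulr1.
Qed.

(* The error a is charged to [set y | 0 < f y], a set which for the next layer
   (f - a)^+ has measure at most L (min f a) / a; hence it does not accumulate
   along the induction on the number of layers. *)
Lemma int_layers a n (f : T -> R) : 0 < a -> continuous f ->
  (forall y, 0 <= f y) -> (forall y, f y <= n%:R * a) ->
  \int[riesz_measure]_y f y <= L f + a * outer_value [set y | 0 < f y].
Proof.
move=> a0; elim: n f => [|n IH] f cf f0 fn.
  have -> : f = fun=> 0.
    by apply/funext => y; apply/eqP; rewrite eq_le f0 -(mul0r a) fn.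
  by rewrite int_cst posfun_cst add0r mulr_ge0 ?outer_value_ge0// ltW.
pose f1 y := Num.min (f y) a; pose f2 y := f y - f1 y.
have cf1 : continuous f1 by apply: cont_min => //; exact: cont_cst.
have cf2 : continuous f2 by exact: contB.
have f10 y : 0 <= f1 y by rewrite le_min f0 ltW.
have f20 y : 0 <= f2 y by rewrite subr_ge0 ge_min lexx.
have -> : \int[riesz_measure]_y f y =
    \int[riesz_measure]_y f1 y + \int[riesz_measure]_y f2 y.
  by rewrite -intD//; congr Rintegral; apply/funext => y; rewrite /f2 subrKC.
have -> : L f = L f1 + L f2.
  by rewrite -LD//; congr L; apply/funext => y; rewrite /f2 subrKC.
have h1 : \int[riesz_measure]_y f1 y <= a * outer_value [set y | 0 < f y].
  apply: (@int_indic_le _ _ _ _ f1 [set y | 0 < f y]) => //.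
    exact: cont_gt_measurable.
  move=> y; rewrite indicE; case: (boolP (y \in _)) => [|/negP].
    by rewrite mulr1 ge_min lexx orbT.
  rewrite inE /= => /negP; rewrite -leNgt => fy.
  by rewrite mulr0 ge_min fy.
have h2 : a * outer_value [set y | 0 < f2 y] <= L f1.
  apply: le_trans (outer_value_gt_le cf1 f10 a0).
  rewrite ler_pM2l//; apply: le_outer_value => y /=.
  by rewrite /f2 subr_gt0 /f1 gt_min ltxx/= => fy; rewrite le_min lexx ltW.
have : \int[riesz_measure]_y f2 y <= L f2 + a * outer_value [set y | 0 < f2 y].
  apply: IH => // y; have := fn y; rewrite -addn1 natrD mulrDl mul1r /f2 /f1.
  have := f0 y; have := mulr_ge0 (ler0n R n) (ltW a0).
  by rewrite /Num.min; case: ltP; lra.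
by lra.
Qed.

(** Adding a constant reduces to nonnegative functions, for which layers of height [e] lose at most
    [e], as outer values are at most 1. One inequality is enough for the representation: [- f]
    supplies the other. *)
Lemma int_riesz_le (f : T -> R) : continuous f ->
  \int[riesz_measure]_y f y <= L f.
Proof.
move=> cf.
have [c fc] := compact_max compactT point (cont_norm cf).
pose g y := f y + `|f c|.
have cg : continuous g by apply: contD => //; exact: cont_cst.
have g0 y : 0 <= g y by rewrite /g; have := fc y; rewrite ler_norml; lra.
have : \int[riesz_measure]_y g y <= L g.
  apply/ler_addgt0Pr => e e0.
  pose n := (Num.truncn ((2 * `|f c|) / e)).+1.
  apply: (le_trans (@int_layers e n g e0 cg g0 _)) => [y|].
    apply: (@le_trans _ _ (2 * `|f c|)).
      by rewrite /g; have := fc y; rewrite ler_norml; lra.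
    by rewrite -ler_pdivrMr// ltW// truncnS_gt.
  rewrite lerD2l -[leRHS]mulr1 ler_pM2l//; exact: outer_value_le (covers1 _).
have cc := @cont_cst T R `|f c|.
by rewrite intD// LD// int_cst posfun_cst lerD2r.
Qed.

Lemma Riesz_Markov : exists mu : probability (borel T) R,
  forall f : T -> R, continuous f -> \int[mu]_y f y = L f.
Proof.
exists riesz_measure => f cf; apply/eqP; rewrite eq_le int_riesz_le//=.
have := int_riesz_le (contN cf).
have -> : \int[riesz_measure]_y (- f y) = - \int[riesz_measure]_y f y.
  by under eq_Rintegral do rewrite -mulN1r; rewrite intZ// mulN1r.
have -> : L (fun y => - f y) = - L f.
  by under eq_fun do rewrite -mulN1r; rewrite LZ// mulN1r.
by rewrite lerN2.
Qed.

End RieszMarkov.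

(** * Duality for Mather measures *)

(** The way back from integrals of continuous functions to measures of sets: it identifies the mass
    of open sets, for comparing marginals, and detects null sets. *)
Lemma int_min_cvg {R : realType} {T : ptopologicalType}
    (compactT : compact [set: T]) (mu : probability (borel T) R) (g : T -> R) :
  continuous g -> (forall y, 0 <= g y) ->
  (\int[mu]_y (Num.min 1 (n%:R * g y))%:E)%E @[n --> \oo] -->
    mu [set y | 0 < g y].
Proof.
move=> cg g0; have mg := @cont_gt_measurable R T g 0 cg.
have -> : mu [set y | 0 < g y] =
    (\int[mu]_y (\1_([set z | 0 < g z] : set (borel T)) y)%:E)%E.
  by rewrite integral_indic// setIT.
apply: (@dominated_cvg _ _ _ _ _ measurableT _ _ (EFin \o cst 1)) => //.
- move=> n; apply/measurable_EFinP; apply: cont_measurable.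
  by apply: cont_min; [exact: cont_cst|exact: contZ].
- move=> y _; apply: cvg_near_cst; have := g0 y.
  rewrite le_eqVlt => /predU1P[gy|gy].
    apply: nearW => n; rewrite indicE memNset/=; last by rewrite -gy ltxx.
    by rewrite -gy mulr0 min_r// ler01.
  exists (Num.truncn (g y)^-1).+1 => // n /= hn.
  rewrite indicE mem_set//= min_l// -ler_pdivrMr// mul1r.
  by apply: le_trans (ltW (truncnS_gt _)) _; rewrite ler_nat.
- exact: finite_measure_integrable_cst.
- move=> n y _; rewrite /= lee_fin ger0_norm ?ge_min ?lexx//.
  by rewrite le_min ler01 mulr_ge0.
Qed.

HB.instance Definition _ (S T : ptopologicalType) := Pointed.on (S * T)%type.

Section Marginals.
Context {R : realType} {X : pmetricType R}.
Hypothesis compactX : compact [set: X].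
Local Notation XX := (X * X)%type.

Lemma compactXX : compact [set: XX].
Proof. by rewrite -setXTT; exact: compact_setX. Qed.

Lemma cont_comp_fst (g : X -> R) : continuous g ->
  continuous (fun p : XX => g p.1).
Proof. exact: (cont_comp cont_fst). Qed.

Lemma cont_comp_snd (g : X -> R) : continuous g ->
  continuous (fun p : XX => g p.2).
Proof. exact: (cont_comp cont_snd). Qed.

Lemma measurable_borel_fst :
  measurable_fun [set: borel XX] (fst : borel XX -> borel X).
Proof.
apply: (@measurability _ _ (borel XX) (borel X) _ _ open) => // _ [U oU <-].
rewrite setTI; apply: sub_sigma_algebra; apply: open_comp => // p _.
exact: cvg_fst.
Qed.

Lemma measurable_borel_snd :
  measurable_fun [set: borel XX] (snd : borel XX -> borel X).
Proof.
apply: (@measurability _ _ (borel XX) (borel X) _ _ open) => // _ [U oU <-].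
rewrite setTI; apply: sub_sigma_algebra; apply: open_comp => // p _.
exact: cvg_snd.
Qed.

Variable mu : probability (borel XX) R.

(** The marginals agree on each open set, by [int_min_cvg] for a function positive exactly there;
    open sets are stable under intersection and generate the Borel sets. *)
Lemma equal_marginals_cont :
  (forall g : X -> R, continuous g ->
    \int[mu]_p g p.1 = \int[mu]_p g p.2) -> has_equal_marginals mu.
Proof.
move=> hg A mA.
pose f1 : {mfun borel XX >-> borel X} := HB.pack
  (fst : borel XX -> borel X) (isMeasurableFun.Build _ _ _ _ _
    measurable_borel_fst).
pose f2 : {mfun borel XX >-> borel X} := HB.pack
  (snd : borel XX -> borel X) (isMeasurableFun.Build _ _ _ _ _
    measurable_borel_snd).
apply: (@measure_unique _ R (borel X) open (fun=> setT) _ _ _ _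
  (distribution mu f1) (distribution mu f2)) => //.
- exact: openI.
- by move=> _; exact: openT.
- by rewrite bigcup_const//; exists 0%N.
- move=> U oU; have [f [cf f0 fU]] := open_cozero oU.
  have h1 : [set y : XX | 0 < f y.1] = fst @^-1` U.
    by apply/seteqP; split=> y /= /fU.
  have h2 : [set y : XX | 0 < f y.2] = snd @^-1` U.
    by apply/seteqP; split=> y /= /fU.
  have l1 := int_min_cvg compactXX (mu:=mu) (cont_comp_fst cf)
    (fun y => f0 y.1).
  have l2 := int_min_cvg compactXX (mu:=mu) (cont_comp_snd cf)
    (fun y => f0 y.2).
  have e12 : (fun n => \int[mu]_y (Num.min 1 (n%:R * f y.2))%:E)%E =
             (fun n => \int[mu]_y (Num.min 1 (n%:R * f y.1))%:E)%E.
    apply/funext => n.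
    have cm : continuous (fun x => Num.min 1 (n%:R * f x)).
      by apply: cont_min; [exact: cont_cst|exact: contZ].
    have i1 := integrable_fin_num measurableT
      (cont_integrable compactXX mu (cont_comp_fst cm)).
    have i2 := integrable_fin_num measurableT
      (cont_integrable compactXX mu (cont_comp_snd cm)).
    by rewrite -(fineK i1) -(fineK i2); congr EFin; apply/esym/(hg _ cm).
  move: l1 l2; rewrite e12 h1 h2 => l1 l2.
  exact: (cvg_unique _ l1 l2).
- by move=> _; apply: le_lt_trans (ltry 1); exact: probability_le1.
Qed.

Lemma int_marginals (g : X -> R) : has_equal_marginals mu -> continuous g ->
  \int[mu]_p g p.1 = \int[mu]_p g p.2.
Proof.
move=> hm cg; congr fine.
have i1 := cont_integrable compactXX mu (cont_comp_fst cg).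
have i2 := cont_integrable compactXX mu (cont_comp_snd cg).
have mg : measurable_fun [set: borel X] (EFin \o (g : borel X -> R)).
  by apply/measurable_EFinP; exact: cont_measurable.
have e1 := integral_pushforward measurable_borel_fst mg i1 measurableT.
have e2 := integral_pushforward measurable_borel_snd mg i2 measurableT.
move: e1 e2; rewrite preimage_setT /= => <- <-.
pose f1 : {mfun borel XX >-> borel X} := HB.pack
  (fst : borel XX -> borel X) (isMeasurableFun.Build _ _ _ _ _
    measurable_borel_fst).
pose f2 : {mfun borel XX >-> borel X} := HB.pack
  (snd : borel XX -> borel X) (isMeasurableFun.Build _ _ _ _ _
    measurable_borel_snd).
apply: (@eq_measure_integral _ _ _ _ (distribution mu f2)).
  exact: measurable_borel_fst.
by move=> mf A mA _; exact: hm.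
Qed.

End Marginals.

Section Duality.
Context {R : realType} {X : pmetricType R}.
Hypothesis compactX : compact [set: X].
Variable c : X -> X -> R.
Hypothesis cont_c : continuous (fun p : X * X => c p.1 p.2).
Variable w : X -> R.
Hypothesis cont_w : continuous w.
Hypothesis w_sub : is_subsolution c w.
Hypothesis w_calibrated : forall x, exists z, w x = w z + c z x.

Definition dominates (f : X * X -> R) (s : R) : Prop :=
  exists C (g : X -> R), [/\ 0 <= C, continuous g &
    forall z x, f (z, x) <= s + C * c z x + g z - g x].

(* By duality, the largest integral of f against a Mather measure. *)
Definition dual_value (f : X * X -> R) : R := inf [set s | dominates f s].

(** At a minimum point [x] of [C * w - g], with [z] optimal for [w] at [x], the quantity
    [C * c z x + g z - g x] is a difference of values of [C * w - g] and is at most 0, so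
    [f (z, x) <= s]. This keeps [dual_value] finite. *)
Lemma dominates_ge f m s : (forall p, m <= f p) -> dominates f s -> m <= s.
Proof.
move=> mf [C [g [C0 cg h]]].
have [x xmin] := compact_min compactX point (contB (contZ (a:=C) cont_w) cg).
have [z wz] := w_calibrated x; have := xmin z => /=; have := h z x.
by have := mf (z, x); rewrite wz mulrDr; lra.
Qed.

Lemma dominates_cst f s : (forall p, f p <= s) -> dominates f s.
Proof.
move=> fs; exists 0, (fun=> 0); split=> //; first exact: cont_cst.
by move=> z x; rewrite mul0r addr0 addr0 subr0.
Qed.

Lemma dual_value_le f s : continuous f -> dominates f s -> dual_value f <= s.
Proof.
move=> cf; apply: ge_inf.
have [q qmin] := compact_min (compactXX compactX) point cf.
by exists (f q) => r; exact: dominates_ge.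
Qed.

Lemma dual_value_ge f r : continuous f ->
  (forall s, dominates f s -> r <= s) -> r <= dual_value f.
Proof.
move=> cf h; apply: lb_le_inf => //.
have [q qmax] := compact_max (compactXX compactX) point cf.
by exists (f q); exact: dominates_cst.
Qed.

Lemma dual_value_adherent f e : continuous f -> 0 < e ->
  dominates f (dual_value f + e).
Proof.
move=> cf e0; have [|s [C [g [C0 cg h]]] sA] :=
    @inf_adherent R [set s | dominates f s] e e0.
  split.
    have [q qmax] := compact_max (compactXX compactX) point cf.
    by exists (f q); exact: dominates_cst.
  have [q qmin] := compact_min (compactXX compactX) point cf.
  by exists (f q) => r; exact: dominates_ge.
exists C, g; split=> // z x; apply: (le_trans (h z x)).
by rewrite /dual_value; lra.
Qed.

Lemma sublinear_dual_value :
  sublinear_on (fun f : X * X -> R => continuous f) dual_value.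
Proof.
split=> [f g cf cg|a f a0 cf].
  have cfg : continuous (f + g) by exact: contD.
  rewrite -lerBlDr; apply: dual_value_ge => // s [C [p [C0 cp hp]]].
  rewrite lerBlDr -lerBlDl; apply: dual_value_ge => // t [D [q [D0 cq hq]]].
  rewrite lerBlDl; apply: dual_value_le => //.
  exists (C + D), (fun x => p x + q x); split; [exact: addr_ge0|exact: contD|].
  move=> z x; rewrite -[leLHS]/(f (z, x) + g (z, x)) mulrDl.
  by have := hp z x; have := hq z x; lra.
have caf : continuous (a *: f) by exact: contZ.
have [->|an0] := eqVneq a 0.
  rewrite mul0r scale0r; apply: dual_value_le; first exact: cont_cst.
  exact: dominates_cst.
have a_gt0 : 0 < a by rewrite lt_neqAle eq_sym an0.
rewrite -ler_pdivrMl//; apply: dual_value_ge => // s [C [p [C0 cp hp]]].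
rewrite ler_pdivrMl//; apply: dual_value_le => //.
exists (a * C), (fun x => a * p x); split; [exact: mulr_ge0|exact: contZ|].
move=> z x; rewrite -[leLHS]/(a * f (z, x)).
by have := ler_wpM2l a0 (hp z x); lra.
Qed.

(** A linear functional below [dual_value] that touches it at [h] is integration against a Mather
    measure, each property coming from an explicit certificate: constants give positivity and mass
    1, [C = 0] with any [g] gives equal marginals, and the integral of [c] is at most 0 by [C = 1],
    [g = 0], at least 0 by [C = 0], [g = w]. *)
Lemma Mather_duality (h : X * X -> R) : continuous h ->
  exists2 mu, is_Mather_measure c mu &
    forall e, 0 < e -> dominates h (\int[mu]_p h p + e).
Proof.
move=> ch.
have [L [[LD LZ] Lle Lge]] := @Hahn_Banach _ _ _
  (fun f g (cf : continuous f) (cg : continuous g) => contD cf cg)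
  (fun a f (cf : continuous f) => contZ (a:=a) cf) _ h sublinear_dual_value ch.
have LZ' a (f : X * X -> R) : continuous f -> L (fun y => a * f y) = a * L f.
  by move=> cf; exact: (LZ a f cf).
have LD' (f g : X * X -> R) : continuous f -> continuous g ->
  L (fun y => f y + g y) = L f + L g by exact: LD.
have L_le (f : X * X -> R) s : continuous f -> dominates f s -> L f <= s.
  by move=> cf fs; apply: (le_trans (Lle _ cf)); exact: dual_value_le.
have LN (f : X * X -> R) : continuous f -> L (fun y => - f y) = - L f.
  by move=> cf; under eq_fun do rewrite -mulN1r; rewrite LZ'// mulN1r.
have L_ge (f : X * X -> R) s : continuous f ->
    dominates (fun y => - f y) (- s) -> s <= L f.
  by move=> cf fs; rewrite -lerN2 -LN//; apply: L_le => //; exact: contN.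
have L_ge0 (f : X * X -> R) : continuous f -> (forall y, 0 <= f y) -> 0 <= L f.
  move=> cf f0; apply: L_ge => //; rewrite oppr0; apply: dominates_cst => p.
  by rewrite oppr_le0.
have L1 : L (fun=> 1) = 1.
  apply/eqP; rewrite eq_le L_le ?L_ge//; try exact: cont_cst.
    exact: dominates_cst.
  exact: dominates_cst.
have oz (U : set (X * X)) : open U -> exists f : X * X -> R,
    [/\ continuous f, forall y, 0 <= f y & forall y, U y <-> 0 < f y].
  exact: open_cozero.
have [mu muL] := Riesz_Markov (compactXX compactX) oz LD' LZ' L_ge0 L1.
have L_diff (g : X -> R) : continuous g -> L (fun p => g p.1 - g p.2) <= 0.
  move=> cg; apply: L_le.
    by apply: contB; [exact: cont_comp_fst|exact: cont_comp_snd].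
  by exists 0, g; split=> // z x; rewrite mul0r addr0 add0r.
have L_marg (g : X -> R) : continuous g ->
    L (fun p => g p.1) = L (fun p => g p.2).
  move=> cg; have c1 := cont_comp_fst cg; have c2 := cont_comp_snd cg.
  have := L_diff _ cg; have := L_diff _ (contN cg) => /=.
  under eq_fun do rewrite opprK addrC.
  by rewrite !LD' ?LN//; try exact: contN; lra.
have mu_marg : has_equal_marginals mu.
  apply: equal_marginals_cont => // g cg.
  by rewrite !muL; [exact: L_marg|exact: cont_comp_snd|exact: cont_comp_fst].
exists mu.
  split=> //; rewrite muL//; apply/eqP; rewrite eq_le; apply/andP; split.
    apply: L_le => //; exists 1, (fun=> 0); split=> //; first exact: cont_cst.
    by move=> z x /=; lra.
  apply: L_ge => //; exists 0, w; split=> // z x /=.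
  by have := w_sub z x; lra.
move=> e e0; rewrite muL//.
have [C [g [C0 cg hg]]] := dual_value_adherent ch e0.
by exists C, g; split=> // z x; apply: (le_trans (hg z x)); lra.
Qed.

Lemma Mather_dominates_le h s : continuous h ->
  (forall mu, is_Mather_measure c mu -> \int[mu]_p h p <= s) ->
  forall e, 0 < e -> dominates h (s + e).
Proof.
move=> ch hs e e0; have [mu muM hmu] := Mather_duality ch.
have [C [g [C0 cg hg]]] := hmu _ e0.
exists C, g; split=> // z x; apply: (le_trans (hg z x)).
by have := hs _ muM; lra.
Qed.

(** The measure of [Mather_duality] attains the largest integral of [h], so strictness for each
    measure leaves a uniform gap, half of which is spent on the certificate. *)
Lemma Mather_dominates_lt h s : continuous h ->
  (forall mu, is_Mather_measure c mu -> \int[mu]_p h p < s) ->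
  exists2 r, r < s & dominates h r.
Proof.
move=> ch hs; have [mu muM hmu] := Mather_duality ch.
have i_lt := hs _ muM.
have e0 : 0 < (s - \int[mu]_p h p) / 2 by rewrite divr_gt0// subr_gt0.
by exists (\int[mu]_p h p + (s - \int[mu]_p h p) / 2); [lra|exact: hmu].
Qed.

End Duality.

(** * The operators T_lambda and the expansion of the cost *)

(** A tube argument. Uniformity over [A] is what makes infima over the compact variable continuous
    in the other one, and later yields equicontinuity. *)
Lemma compact_unif_near {R : realType} {S1 S2 : topologicalType} (A : set S1)
    (F : S1 -> S2 -> R) (s : S2) (e : R) :
  compact A -> continuous (fun p : S1 * S2 => F p.1 p.2) -> 0 < e ->
  \forall s' \near s, forall z, A z -> `|F z s' - F z s| < e.
Proof.
move=> /compact_near_coveringP cA cF e0.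
apply: (cA _ (nbhs s) (fun s' z => `|F z s' - F z s| < e)) => z Az.
have e20 : 0 < e / 2 by rewrite divr_gt0.
have /continuousP_lt/(_ (z, s) _ e20) := cF => -[[P Q] /= [Pz Qs] PQ].
exists (P, Q) => // -[z' s'] /= [Pz' Qs'].
have := PQ (z', s') (conj Pz' Qs').
have := PQ (z', s) (conj Pz' (nbhs_singleton Qs)) => /=.
by rewrite !ltr_norml; lra.
Qed.

Section Minimum.
Context {R : realType} {X : pmetricType R}.
Hypothesis compactX : compact [set: X].

Lemma minimum_le (f : X -> R) y : continuous f -> minimum f <= f y.
Proof.
move=> cf; apply: ge_inf; last by exists y.
have [q qmin] := compact_min compactX point cf.
by exists (f q) => _ [z _ <-].
Qed.

Lemma minimum_ge (f : X -> R) r : (forall y, r <= f y) -> r <= minimum f.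
Proof.
move=> h; apply: lb_le_inf; first by exists (f point), point.
by move=> _ [z _ <-].
Qed.

Lemma minimum_attained (f : X -> R) : continuous f ->
  exists z, minimum f = f z.
Proof.
move=> cf; have [q qmin] := compact_min compactX point cf.
by exists q; apply/eqP; rewrite eq_le minimum_le//= minimum_ge.
Qed.

Lemma cont_slice {S : topologicalType} (F : X -> S -> R) s :
  continuous (fun p : X * S => F p.1 p.2) -> continuous (F^~ s).
Proof.
move=> cF; apply: (cont_comp (f:=fun z => (z, s))) cF.
by apply: cont_pair; [exact: cont_id|exact: cont_cst].
Qed.

Lemma cont_minimum {S : topologicalType} (F : X -> S -> R) :
  continuous (fun p : X * S => F p.1 p.2) ->
  continuous (fun s => minimum (F^~ s)).
Proof.
move=> cF; apply/continuousP_lt => s e e0.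
have e20 : 0 < e / 2 by rewrite divr_gt0.
have := compact_unif_near s compactX cF e20; apply: filterS => s' h.
have [z hz] := minimum_attained (cont_slice (s:=s) cF).
have [z' hz'] := minimum_attained (cont_slice (s:=s') cF).
have := minimum_le z' (cont_slice (s:=s) cF).
have := minimum_le z (cont_slice (s:=s') cF).
have := h z I; have := h z' I; rewrite !hz !hz' !ltr_norml.
by lra.
Qed.

End Minimum.

Section Cost.
Context {R : realType} {X : pmetricType R}.
Hypothesis compactX : compact [set: X].
Variable l : X -> X -> R -> R -> R.
Hypothesis continuous_l : continuous
  (fun p : (X * X) * (R * R) => l p.1.1 p.1.2 p.2.1 p.2.2).

Lemma cont_cost {S : topologicalType} (z x : S -> X) (u v : S -> R) :
  continuous z -> continuous x -> continuous u -> continuous v ->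
  continuous (fun s => l (z s) (x s) (u s) (v s)).
Proof.
move=> cz cx cu cv.
apply: (cont_comp (f:=fun s => ((z s, x s), (u s, v s)))) continuous_l.
by apply: cont_pair; exact: cont_pair.
Qed.

Lemma cont_cost0 : continuous (fun p : X * X => cost0 l p.1 p.2).
Proof.
by apply: cont_cost; [exact: cont_fst|exact: cont_snd|exact: cont_cst..].
Qed.

Hypothesis hl2 : cond_l2 l.

Lemma le_cost z x u u' v v' : u <= u' -> v <= v' ->
  l z x u' v' <= l z x u v.
Proof.
move=> uu vv; have [h1 h2] := hl2.
exact: le_trans (h2 z x u' _ _ vv) (h1 z x v _ _ uu).
Qed.

(** The equation is implicit in [psi x]. As [l] is non-increasing in [v], the function [h (x, t)]
    grows in [t] at rate at least 1: it has a root within [|h (x, 0)|] of the origin, and the signs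
    of [h] at [psi x - e] and [psi x + e] persist for nearby points, which confines the root
    there. *)
Lemma Tlambda_image_exists lam phi : 0 <= lam -> continuous phi ->
  exists psi, is_Tlambda_image l lam phi psi.
Proof.
move=> lam0 cphi.
pose F z (s : X * R) := phi z + l z s.1 (lam * phi z) (lam * s.2).
have cF : continuous (fun p : X * (X * R) => F p.1 p.2).
  have c1 : continuous (fun p : X * (X * R) => phi p.1).
    exact: (cont_comp cont_fst).
  apply: contD => //; apply: cont_cost.
  - exact: cont_fst.
  - exact: (cont_comp cont_snd cont_fst).
  - exact: contZ.
  - by apply: contZ; exact: (cont_comp cont_snd cont_snd).
pose h s : R := s.2 - minimum (F^~ s).
have ch : continuous (h : X * R -> R).
  by apply: contB; [exact: cont_snd|exact: cont_minimum].
have ht x : continuous (fun t => h (x, t)).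
  apply: (cont_comp (f:=fun t => (x, t))) ch.
  by apply: cont_pair; [exact: cont_cst|exact: cont_id].
have hx t : continuous (fun x => h (x, t)).
  apply: (cont_comp (f:=fun x => (x, t))) ch.
  by apply: cont_pair; [exact: cont_id|exact: cont_cst].
have h_incr x t t' : t <= t' -> h (x, t) + (t' - t) <= h (x, t').
  move=> tt; rewrite /h /=.
  suff : minimum (F^~ (x, t')) <= minimum (F^~ (x, t)) by lra.
  apply: minimum_ge => z; apply: le_trans (minimum_le compactX z _) _.
    exact: (cont_slice (s:=(x, t')) cF).
  by rewrite lerD2l le_cost// ler_wpM2l.
have h_root x : exists t, h (x, t) = 0.
  set A := `|h (x, 0)|.
  have A0 : 0 <= A by exact: normr_ge0.
  have AA : - A <= A by lra.
  have [t _ ht0] : exists2 t, t \in `[- A, A] & h (x, t) = 0.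
    apply: IVT => //; first exact: continuous_subspaceT (ht x).
    have h1 := h_incr x _ _ A0; have h2 : - A <= 0 by lra.
    have := h_incr x _ _ h2; have := ler_norm (h (x, 0)).
    have := ler_norm (- h (x, 0)); rewrite normrN -/A => h4 h5 h6.
    by rewrite ge_min le_max; apply/andP; split; apply/orP; [left|right]; lra.
  by exists t.
have [psi psi0] := choice h_root.
exists psi; split; last first.
  by move=> x; have := psi0 x; rewrite /h /=; lra.
apply/continuousP_lt => x e e0.
have e20 : 0 < e / 2 by rewrite divr_gt0.
have /continuousP_lt/(_ x _ e20) near_lo := hx (psi x - e).
have /continuousP_lt/(_ x _ e20) near_hi := hx (psi x + e).
near=> y.
have lo : h (y, psi x - e) < 0.
  have xe : psi x - e <= psi x by lra.
  have := h_incr x _ _ xe; rewrite psi0 => he.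
  have : `|h (y, psi x - e) - h (x, psi x - e)| < e / 2 by near: y.
  by rewrite ltr_norml; lra.
have hi : 0 < h (y, psi x + e).
  have xe : psi x <= psi x + e by lra.
  have := h_incr x _ _ xe; rewrite psi0 => he.
  have : `|h (y, psi x + e) - h (x, psi x + e)| < e / 2 by near: y.
  by rewrite ltr_norml; lra.
rewrite ltr_norml; apply/andP; split.
  rewrite ltNge; apply/negP => le1.
  have le2 : psi y <= psi x - e by lra.
  by have := h_incr y _ _ le2; rewrite psi0; lra.
rewrite ltNge; apply/negP => le1.
have le2 : psi x + e <= psi y by lra.
by have := h_incr y _ _ le2; rewrite psi0; lra.
Unshelve. all: by end_near. Qed.

Lemma Tlambda_fixed lam phi : 0 <= lam -> continuous phi ->
  Tlambda l lam phi = phi ->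
  (forall z x, phi x - phi z <= l z x (lam * phi z) (lam * phi x)) /\
  (forall x, exists z, phi x - phi z = l z x (lam * phi z) (lam * phi x)).
Proof.
move=> lam0 cphi fix_phi.
(* [get] returns a default when nothing satisfies the predicate, so the equation for [phi] is
   obtained from the existence of an image. *)
have [_] : is_Tlambda_image l lam phi phi.
  by rewrite -{2}fix_phi; apply: getPex; exact: Tlambda_image_exists.
move=> hphi.
have cF x : continuous (fun z => phi z + l z x (lam * phi z) (lam * phi x)).
  apply: contD => //; apply: cont_cost => //;
    [exact: cont_id|exact: cont_cst|exact: contZ|exact: cont_cst].
split=> [z x|x].
  by rewrite lerBlDl {1}hphi; exact: (minimum_le compactX z (cF x)).
have [z hz] := minimum_attained compactX (cF x).
by exists z; rewrite {1}hphi hz addrC addKr.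
Qed.

Lemma critical_solution : is_critical_constant (cost0 l) 0 ->
  exists w, [/\ continuous w, is_subsolution (cost0 l) w &
    forall x, exists z, w x = w z + cost0 l z x].
Proof.
move=> [w cw hw]; exists w.
have cF x : continuous (fun z => w z + cost0 l z x).
  apply: contD => //; apply: cont_cost; [exact: cont_id|exact: cont_cst..].
split=> // [z x|x].
  by rewrite lerBlDl hw addr0; exact: (minimum_le compactX z (cF x)).
have [z hz] := minimum_attained compactX (cF x).
by exists z; rewrite {1}hw addr0 -hz.
Qed.

End Cost.

Lemma cont_uniform_approx {R : realType} {S : topologicalType} (f : S -> R) :
  (forall e, 0 < e -> exists2 g : S -> R, continuous g &
    forall s, `|f s - g s| <= e) -> continuous f.
Proof.
move=> h; apply/continuousP_lt => s e e0.
have e30 : 0 < e / 4 by rewrite divr_gt0.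
have [g cg fg] := h _ e30.
have /continuousP_lt/(_ s _ e30) := cg; apply: filterS => t.
by have := fg s; have := fg t; rewrite !ler_norml !ltr_norml; lra.
Qed.

(** * First-order expansion of the cost, uniform over pairs *)

Section FirstOrder.
Context {R : realType} {X : pmetricType R}.
Variable l : X -> X -> R -> R -> R.
Hypothesis continuous_l : continuous
  (fun p : (X * X) * (R * R) => l p.1.1 p.1.2 p.2.1 p.2.2).
Hypothesis hl2 : cond_l2 l.
Hypothesis hl3 : cond_l3 l.

Lemma cost_expansion e : 0 < e -> exists2 s0, 0 < s0 &
  forall z x u v s, `|u| <= s -> `|v| <= s -> s <= s0 ->
    `|l z x u v - cost0 l z x - du0 l z x * u - dv0 l z x * v| <= e * s.
Proof.
move=> e0; have [_ [eta [eta0 eta_mono _ eta_cvg] heta]] := hl3.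
have /cvgrPdist_lt/(_ _ e0) [d /= d0 hd] := eta_cvg.
exists (d / 2); first by rewrite divr_gt0.
move=> z x u v s us vs sd; apply: (le_trans (heta z x u v)).
set r := (`|u| + `|v|) / 2.
have r0 : 0 <= r by rewrite divr_ge0// addr_ge0.
have rs : r <= s by rewrite /r; lra.
have s0 := le_trans r0 rs.
move: r0; rewrite le_eqVlt => /predU1P[<-|r0].
  by rewrite mul0r mulr_ge0// ltW.
have : `|0 - eta r| < e.
  by apply: hd => //=; rewrite sub0r normrN gtr0_norm//; lra.
rewrite sub0r normrN => /(le_lt_trans (ler_norm _)) /ltW er.
by rewrite mulrC; apply: ler_pM; rewrite ?eta0 ?(ltW r0).
Qed.

(** A difference quotient at one step [s] is accurate for all pairs at once; the sign and the
    continuity of [du0] are inherited from such quotients. *)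
Lemma du0_approx e : 0 < e -> exists2 s, 0 < s &
  forall z x, `|du0 l z x - (l z x s 0 - cost0 l z x) / s| <= e.
Proof.
move=> /cost_expansion[s s0 hs]; exists s => // z x.
have := hs z x s 0 s; rewrite normr0 gtr0_norm// lexx (ltW s0) mulr0 subr0.
move=> /(_ isT isT isT) h.
have -> : du0 l z x - (l z x s 0 - cost0 l z x) / s =
    (du0 l z x * s - (l z x s 0 - cost0 l z x)) / s.
  by field; exact: lt0r_neq0.
by rewrite normrM [`|s^-1|]gtr0_norm ?invr_gt0// ler_pdivrMr// distrC.
Qed.

Lemma dv0_approx e : 0 < e -> exists2 s, 0 < s &
  forall z x, `|dv0 l z x - (l z x 0 s - cost0 l z x) / s| <= e.
Proof.
move=> /cost_expansion[s s0 hs]; exists s => // z x.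
have := hs z x 0 s s; rewrite normr0 gtr0_norm// lexx (ltW s0) mulr0 subr0.
move=> /(_ isT isT isT) h.
have -> : dv0 l z x - (l z x 0 s - cost0 l z x) / s =
    (dv0 l z x * s - (l z x 0 s - cost0 l z x)) / s.
  by field; exact: lt0r_neq0.
by rewrite normrM [`|s^-1|]gtr0_norm ?invr_gt0// ler_pdivrMr// distrC.
Qed.

Lemma du0_le0 z x : du0 l z x <= 0.
Proof.
apply/ler_addgt0Pr => e e0; have [s s0 hs] := du0_approx e0; rewrite add0r.
have : (l z x s 0 - cost0 l z x) / s <= 0.
  rewrite pmulr_lle0 ?invr_gt0// subr_le0.
  exact: (le_cost hl2 z x (ltW s0) (lexx 0)).
by have := hs z x; rewrite ler_norml; lra.
Qed.

Lemma dv0_le0 z x : dv0 l z x <= 0.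
Proof.
apply/ler_addgt0Pr => e e0; have [s s0 hs] := dv0_approx e0; rewrite add0r.
have : (l z x 0 s - cost0 l z x) / s <= 0.
  rewrite pmulr_lle0 ?invr_gt0// subr_le0.
  exact: (le_cost hl2 z x (lexx 0) (ltW s0)).
by have := hs z x; rewrite ler_norml; lra.
Qed.

Lemma cont_du0 : continuous (fun p : X * X => du0 l p.1 p.2).
Proof.
apply: cont_uniform_approx => e /du0_approx[s s0 hs].
exists (fun p => s^-1 * (l p.1 p.2 s 0 - cost0 l p.1 p.2)).
  apply: contZ; apply: contB; last exact: cont_cost0.
  by apply: cont_cost; [|exact: cont_fst|exact: cont_snd|exact: cont_cst..].
by move=> p; rewrite mulrC.
Qed.

Lemma cont_dv0 : continuous (fun p : X * X => dv0 l p.1 p.2).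
Proof.
apply: cont_uniform_approx => e /dv0_approx[s s0 hs].
exists (fun p => s^-1 * (l p.1 p.2 0 s - cost0 l p.1 p.2)).
  apply: contZ; apply: contB; last exact: cont_cost0.
  by apply: cont_cost; [|exact: cont_fst|exact: cont_snd|exact: cont_cst..].
by move=> p; rewrite mulrC.
Qed.

End FirstOrder.

(** * Regularisation of subsolutions *)

Section AlmostEverywhere.
Local Open Scope ereal_scope.
Context d {T : measurableType d} {R : realType}.
Variable mu : {measure set T -> \bar R}.
Variable A : set T.
Hypothesis mA : measurable A.
Hypothesis muA : mu (~` A) = 0.

Import HBNNSimple.

(** Neither function is assumed measurable, as subsolutions need not be Borel. A simple function
    below [f], cut down to [A], lies below [g] and keeps its integral. *)
Lemma ge0_le_integral_on (f g : T -> \bar R) : (forall x, 0 <= f x) ->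
  (forall x, 0 <= g x) -> (forall x, A x -> f x = g x) ->
  \int[mu]_x f x <= \int[mu]_x g x.
Proof.
move=> f0 g0 fg; rewrite !ge0_integralTE//; apply: ge_ereal_sup => _ [h hf <-].
have -> : sintegral mu h = sintegral mu (proj_nnsfun h mA).
  rewrite -!integralT_nnsfun; apply: ae_eq_integral => //.
  - exact/measurable_EFinP.
  - exact/measurable_EFinP.
  exists (~` A); split => //; first exact: measurableC.
  move=> x /= hx Ax; apply: hx => _ /=.
  by rewrite mindicE mem_set// mulr1.
apply: ereal_sup_ubound; exists (proj_nnsfun h mA) => // x /=.
rewrite mindicE; case: (boolP (x \in A)) => [|_].
  by rewrite inE mulr1 => Ax; rewrite -fg.
by rewrite mulr0.
Qed.

Lemma Rintegral_eq_on (f g : T -> R) : (forall x, A x -> f x = g x) ->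
  (\int[mu]_x f x = \int[mu]_x g x)%R.
Proof.
move=> fg; congr fine; rewrite integralE [RHS]integralE.
congr (_ - _); apply/eqP; rewrite eq_le !ge0_le_integral_on// => x Ax;
  by rewrite ?funeposE ?funenegE fg.
Qed.

End AlmostEverywhere.

Lemma int0_null {R : realType} {T : ptopologicalType}
    (compactT : compact [set: T]) (mu : probability (borel T) R) (f : T -> R) :
  continuous f -> (forall y, 0 <= f y) -> \int[mu]_y f y = 0 ->
  mu [set y | 0 < f y] = 0%E.
Proof.
move=> cf f0 intf.
have := int_min_cvg compactT (mu:=mu) cf f0.
have -> : (fun n => \int[mu]_y (Num.min 1 (n%:R * f y))%:E)%E = fun=> 0%E.
  apply/funext => n.
  have cm : continuous (fun y => Num.min 1 (n%:R * f y)).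
    by apply: cont_min; [exact: cont_cst|exact: contZ].
  have im := cont_integrable compactT mu cm.
  rewrite -(fineK (integrable_fin_num measurableT im)).
  congr EFin; apply/eqP; rewrite eq_le; apply/andP; split; last first.
    by apply: Rintegral_ge0 => y _; rewrite le_min ler01 mulr_ge0.
  rewrite -[leRHS](mulr0 n%:R) -intf -(intZ compactT mu _ cf).
  apply: (le_int compactT mu cm (contZ cf)) => y.
  by rewrite ge_min lexx orbT.
by move=> h; exact: (cvg_unique _ h (cvg_cst _)).
Qed.

Section Regularisation.
Context {R : realType} {X : pmetricType R}.
Hypothesis compactX : compact [set: X].
Variable c : X -> X -> R.
Hypothesis cont_c : continuous (fun p : X * X => c p.1 p.2).
Variable w : X -> R.
Hypothesis w_sub : is_subsolution c w.

Lemma T0_has_lbound x : has_lbound (range (fun z => w z + c z x)).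
Proof. by exists (w x) => _ [z _ <-]; have := w_sub z x; lra. Qed.

Lemma T0_le z x : T0 c w x <= w z + c z x.
Proof. by apply: ge_inf; [exact: T0_has_lbound|exists z]. Qed.

Lemma T0_ge x r : (forall z, r <= w z + c z x) -> r <= T0 c w x.
Proof. exact: minimum_ge. Qed.

Lemma subsolution_le_T0 x : w x <= T0 c w x.
Proof. by apply: T0_ge => z; have := w_sub z x; lra. Qed.

Lemma T0_subsolution : is_subsolution c (T0 c w).
Proof.
by move=> x y; have := T0_le x y; have := subsolution_le_T0 x; lra.
Qed.

(** Here [w] may be discontinuous: [x] enters [w z + c z x] only through [c], whose variation near
    [x] is uniform in [z]. *)
Lemma cont_T0 : continuous (T0 c w).
Proof.
apply/continuousP_lt => x e e0.
have e20 : 0 < e / 2 by rewrite divr_gt0.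
have := compact_unif_near x compactX cont_c e20; apply: filterS => y hy.
rewrite ltr_norml; apply/andP; split.
  suff : T0 c w x - e / 2 <= T0 c w y by lra.
  apply: T0_ge => z; have := T0_le z x; have := hy z I.
  by rewrite ltr_norml; lra.
suff : T0 c w y - e / 2 <= T0 c w x by lra.
apply: T0_ge => z; have := T0_le z y; have := hy z I.
by rewrite ltr_norml; lra.
Qed.

Variable mu : probability (borel (X * X)%type) R.
Hypothesis muM : is_Mather_measure c mu.

(* Where c z x = T0 w x - T0 w z, the bound T0 w x <= w z + c z x shows that
   T0 w and w agree at z. Equality of the marginals transfers this to the second
   coordinate, through the projection of a closed set, which is Borel. *)
Lemma T0_ae_eq : exists A : set (borel (X * X)%type),
  [/\ measurable A, mu (~` A) = 0%E &
      forall p, A p -> w p.1 = T0 c w p.1 /\ w p.2 = T0 c w p.2].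
Proof.
have cXX := compactXX compactX.
have [mm mc] := muM.
pose s (p : X * X) := c p.1 p.2 - (T0 c w p.2 - T0 c w p.1).
have c1 := cont_comp_fst cont_T0; have c2 := cont_comp_snd cont_T0.
have cs : continuous s by apply: contB => //; exact: contB.
have s0 p : 0 <= s p by have := T0_subsolution p.1 p.2; rewrite /s; lra.
have ints : \int[mu]_p s p = 0.
  rewrite (intB cXX mu cont_c (contB c2 c1)) mc (intB cXX mu c2 c1).
  by rewrite (int_marginals compactX mm cont_T0) !subrr.
pose N := [set p | 0 < s p].
have muN : mu N = 0%E by exact: int0_null.
have oN : open N.
  rewrite (_ : N = s @^-1` [set r | 0 < r])//.
  by apply: open_comp; [move=> p _; exact: cs|exact: open_gt].
have cF : closed (~` N) by exact: open_closedC.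
pose K := fst @` (~` N).
have cK : closed K.
  apply: compact_closed; first exact: metric_hausdorff.
  apply: continuous_compact.
    by apply: continuous_subspaceT => p; exact: cvg_fst.
  exact: (subclosed_compact cF cXX).
have mN : measurable (N : set (borel (X * X)%type)) by exact: sub_sigma_algebra.
have mKC : measurable (~` K : set (borel X)).
  by apply: sub_sigma_algebra; exact: closed_openC.
have mfst : measurable (fst @^-1` (~` K) : set (borel (X * X)%type)).
  by rewrite -[X in measurable X]setTI; exact: measurable_borel_fst.
have msnd : measurable (snd @^-1` (~` K) : set (borel (X * X)%type)).
  by rewrite -[X in measurable X]setTI; exact: measurable_borel_snd.
have musnd : mu (snd @^-1` (~` K)) = 0%E.
  rewrite -[LHS](mm _ mKC) /pushforward; apply/eqP.
  rewrite eq_le measure_ge0 andbT -muN; apply: le_measure; rewrite ?inE//.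
  by move=> p /= Kp; apply: contrapT => nN; apply: Kp; exists p.
have agree p : ~ N p -> w p.1 = T0 c w p.1.
  move=> nN; apply/eqP; rewrite eq_le subsolution_le_T0/=.
  have sp : s p <= 0 by rewrite leNgt; apply/negP.
  by have := T0_le p.1 p.2; move: sp; rewrite /s; lra.
exists (~` (N `|` snd @^-1` (~` K))); split.
- by apply: measurableC; exact: measurableU.
- by rewrite setCK; exact: null_set_setU.
- move=> p /not_orP[nN /contrapT[q nNq <-]]; split; exact: agree.
Qed.

End Regularisation.

(** * Asymptotics of the fixed points *)

Section DiscountedAlgebra.
Context {R : realFieldType}.
Variables (lam B K e1 a b uz ux cost : R).
Hypotheses (lam_gt0 : 0 < lam) (a0 : 0 <= a) (b0 : 0 <= b) (aB : a <= B)
  (bB : b <= B).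
Hypotheses (uzK : `|uz| <= K) (uxK : `|ux| <= K).
Hypothesis u_eq :
  `|ux - uz - cost + lam * (a * uz + b * ux)| <= e1 * (lam * K).

Lemma norm_weighted_le (s t M : R) : `|s| <= M -> `|t| <= M ->
  `|a * s + b * t| <= 2 * B * M.
Proof.
move=> sM tM; apply: le_trans (ler_normD _ _) _.
rewrite !normrM (ger0_norm a0) (ger0_norm b0).
have : a * `|s| <= B * M by exact: ler_pM.
have : b * `|t| <= B * M by exact: ler_pM.
by lra.
Qed.

Lemma cost_gap_le : cost - (ux - uz) <= lam * (2 * B * K + e1 * K).
Proof.
have /ler_normlP[_ h] := norm_weighted_le uzK uxK.
have := ler_wpM2l (ltW lam_gt0) h.
by move: u_eq; rewrite ler_norml => /andP[]; lra.
Qed.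

(** Subtracting the expansion for [u] from [vx - vz <= cost] leaves [lam * (a * vz + b * vx)],
    bounded by the certificate; its [C1 * cost + gz - gx] is a difference of [C1 * u - g] up to
    O(lam) and moves to the left. The error [e1 * (K + 2)] collects [e1 * K] from the expansion,
    [e1] from the certificate and [e1] from the second-order terms. *)
Lemma discounted_difference (C1 G vz vx gz gx : R) :
  0 <= C1 -> vx - vz <= cost ->
  a * vz + b * vx <= e1 + C1 * cost + gz - gx ->
  `|C1 * uz - gz| <= G -> `|C1 * ux - gx| <= G ->
  lam * (C1 * (2 * B * K + e1 * K) + 2 * B * G) <= e1 ->
  (1 + lam * b) * (vx - ux - lam * (C1 * ux - gx)) <=
  (1 - lam * a) * (vz - uz - lam * (C1 * uz - gz)) + lam * (e1 * (K + 2)).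
Proof.
move=> C10 v_le h_le GzG GxG small.
have lam0 := ltW lam_gt0.
have h1 := ler_wpM2l lam0 h_le.
have h2 := ler_wpM2l lam0 (ler_wpM2l C10 cost_gap_le).
have /ler_normlP[h3 _] := norm_weighted_le GzG GxG.
have h4 := ler_wpM2l lam0 (ler_wpM2l lam0 h3).
have h5 := ler_wpM2l lam0 small.
have /ler_normlP[h6 _] := u_eq.
by lra.
Qed.

(** The nondegeneracy certificate makes the left weight exceed the right one by at least
    [lam * (d / 2)]: the main term is [lam * d], and each smallness condition removes a quarter of
    it. *)
Lemma discounted_contraction (C d gz gx Ga f e' : R) :
  0 <= C -> - (a + b) <= - d + C * cost + gz - gx ->
  `|C * uz - gz| <= Ga -> `|C * ux - gx| <= Ga ->
  lam * (C * (2 * B * K + e1 * K)) <= d / 4 -> lam * (2 * B * Ga) <= d / 4 ->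
  0 <= f ->
  (1 + lam * b) * (f * (1 + lam * (C * ux - gx))) <=
  (1 - lam * a) * (f * (1 + lam * (C * uz - gz))) + lam * e' ->
  f * d <= 2 * e'.
Proof.
move=> C0 nd GzG GxG small1 small2 f0 h.
have lam0 := ltW lam_gt0.
have h1 := ler_wpM2l C0 cost_gap_le.
have /ler_normlP[h2 _] := norm_weighted_le GzG GxG.
have h3 := ler_wpM2l lam0 h2.
have h4 : d / 2 <= a + b + (C * ux - gx) - (C * uz - gz) +
    lam * (a * (C * uz - gz) + b * (C * ux - gx)) by lra.
have h5 := ler_wpM2l (mulr_ge0 lam0 f0) h4.
have : lam * (f * d / 2) <= lam * e' by lra.
by rewrite ler_pM2l//; lra.
Qed.

End DiscountedAlgebra.

(** * Bounds, equicontinuity and limits of the family [u lam] *)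

Section Discounted.
Context {R : realType} {X : pmetricType R}.
Hypothesis compactX : compact [set: X].
Variable l : X -> X -> R -> R -> R.
Hypothesis continuous_l : continuous
  (fun p : (X * X) * (R * R) => l p.1.1 p.1.2 p.2.1 p.2.2).
Variables ku kv : R.
Hypothesis hl1 : cond_l1 l ku kv.
Hypothesis hl2 : cond_l2 l.
Hypothesis hl3 : cond_l3 l.
Hypothesis hl4 : cond_l4 l.
Variable w : X -> R.
Hypothesis cont_w : continuous w.
Hypothesis w_sub : is_subsolution (cost0 l) w.
Hypothesis w_calibrated : forall x, exists z, w x = w z + cost0 l z x.
Variable lam0 : R.
Hypothesis lam0_gt0 : 0 < lam0.
Hypothesis lam0_small : lam0 * Num.max ku kv < 1.
Variable u : R -> X -> R.
Hypothesis continuous_u : forall lam, 0 < lam -> lam < lam0 ->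
  continuous (u lam).
Hypothesis u_sub : forall lam, 0 < lam -> lam < lam0 -> forall z x,
  u lam x - u lam z <= l z x (lam * u lam z) (lam * u lam x).
Hypothesis u_calibrated : forall lam, 0 < lam -> lam < lam0 ->
  forall x, exists z,
    u lam x - u lam z = l z x (lam * u lam z) (lam * u lam x).

Local Notation c := (cost0 l).
Local Notation du := (du0 l).
Local Notation dv := (dv0 l).

Let cc : continuous (fun p : X * X => c p.1 p.2) := cont_cost0 continuous_l.
Let cdu := cont_du0 continuous_l hl3.
Let cdv := cont_dv0 continuous_l hl3.

Lemma nondegenerate : exists d C (g : X -> R),
  [/\ 0 < d, 0 <= C, continuous g & forall z x,
    du z x + dv z x <= - d + C * c z x + g z - g x].
Proof.
have [r r0 [C [g [C0 cg hg]]]] := Mather_dominates_lt compactX cc cont_w w_sub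
  w_calibrated (contD cdu cdv) hl4.
exists (- r), C, g; split=> //; rewrite ?oppr_gt0// => z x.
by rewrite opprK; exact: hg.
Qed.

Lemma cost_lipschitz z x p q : l z x p q <= c z x + ku * `|p| + kv * `|q|.
Proof.
have [_ _ hu hv] := hl1.
have := hu z x q (p, 0) (conj I I); have := hv z x 0 (q, 0) (conj I I).
by rewrite /= !subr0 !ler_norml /cost0; lra.
Qed.

Lemma pair_bounded (f : X -> X -> R) :
  continuous (fun p : X * X => f p.1 p.2) ->
  exists2 M : R, 0 <= M & forall z x, `|f z x| <= M.
Proof.
move=> cf.
have [q qmax] := compact_max (compactXX compactX) point (cont_norm cf).
by exists `|f q.1 q.2| => // z x; exact: (qmax (z, x)).
Qed.

Lemma cont_bounded (f : X -> R) : continuous f ->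
  exists2 M : R, 0 <= M & forall x, `|f x| <= M.
Proof.
move=> cf; have [q qmax] := compact_max compactX point (cont_norm cf).
by exists `|f q|.
Qed.

Lemma no_strict_decrease (H : X -> R) e : continuous H -> 0 < e ->
  (forall x, exists z, H z <= H x - e) -> False.
Proof.
move=> cH e0 h; have [x xmin] := compact_min compactX point cH.
by have [z] := h x; have := xmin z; lra.
Qed.

(** If the maximum exceeded [M], then [lam * ku < 1] would force [u lam] above some [m > 0]
    everywhere. By monotonicity the cost is then at most its value at equal small arguments [s],
    [s], where the expansion and the certificate apply; on pairs optimal for [w], where [c] is a
    coboundary, [(1 + s * C) * w - u lam - s * g] would decrease forever. *)
Lemma u_le lam M : 0 < lam -> lam < lam0 -> 0 <= M ->
  (forall z x, `|c z x| <= M) -> forall x, u lam x <= M.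
Proof.
move=> lam_gt0 lam_lt M0 cM.
have [x0 x0max] := compact_max compactX point (continuous_u lam_gt0 lam_lt).
move=> x; apply: (le_trans (x0max x)); rewrite leNgt; apply/negP => uM.
have lamku : lam * ku < 1.
  apply: le_lt_trans lam0_small.
  have [ku0 _ _ _] := hl1.
  by apply: ler_pM; rewrite ?(ltW lam_gt0) ?(ltW lam_lt)// le_max lexx.
have lamu0 : 0 <= lam * u lam x0.
  by rewrite mulr_ge0 ?(ltW lam_gt0)// (le_trans M0)// ltW.
have u_ge z : u lam x0 - M <= u lam z.
  have := u_sub lam_gt0 lam_lt z x0; have := cM z x0; rewrite ler_norml.
  have [uz|uz] := leP 0 (u lam z).
    have := le_cost hl2 z x0 (mulr_ge0 (ltW lam_gt0) uz) lamu0.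
    by rewrite -/(c z x0); lra.
  have := le_cost hl2 z x0 (lexx (lam * u lam z)) lamu0.
  have := cost_lipschitz z x0 (lam * u lam z) 0.
  rewrite normr0 mulr0 addr0 normrM gtr0_norm// ltr0_norm//.
  have : 0 < (1 - lam * ku) * (- u lam z).
    by rewrite mulr_gt0 ?oppr_gt0// subr_gt0.
  by lra.
set m := u lam x0 - M in u_ge.
have m0 : 0 < m by rewrite subr_gt0.
have [d [C [g [d0 C0 cg hg]]]] := nondegenerate.
have d20 : 0 < d / 2 by rewrite divr_gt0.
have [s0 s0_gt0 hs0] := cost_expansion hl3 d20.
pose s := Num.min (lam * m) s0.
have s_gt0 : 0 < s by rewrite lt_min s0_gt0 mulr_gt0.
have s_le : s <= s0 by rewrite ge_min lexx orbT.
have s_lam z : s <= lam * u lam z.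
  by rewrite ge_min; apply/orP; left; rewrite ler_pM2l.
apply: (@no_strict_decrease (fun x => (1 + s * C) * w x - u lam x - s * g x)
  (s * (d / 2))); last 2 first.
- by rewrite mulr_gt0.
- move=> y; have [z wz] := w_calibrated y; exists z.
  have := u_sub lam_gt0 lam_lt z y.
  have := le_cost hl2 z y (s_lam z) (s_lam y).
  have := hs0 z y s s s; rewrite gtr0_norm// lexx s_le => /(_ isT isT isT).
  have := ler_wpM2l (ltW s_gt0) (hg z y).
  rewrite wz ler_norml => h1 /andP[_ h2] h3 h4.
  by nra.
- apply: contB; last exact: contZ.
  by apply: contB; [exact: contZ|exact: continuous_u].
Qed.

(** The mirror image of [u_le]: the pairs are now optimal for [u lam], and [w] enters through its
    subsolution inequality. *)
Lemma u_ge : exists lam1 M, [/\ 0 < lam1, lam1 <= lam0, 0 <= M &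
  forall lam x, 0 < lam -> lam < lam1 -> - M <= u lam x].
Proof.
have [M M0 cM] := pair_bounded cc.
have [ku0 kv0 _ _] := hl1.
have [d [C [g [d0 C0 cg hg]]]] := nondegenerate.
have d20 : 0 < d / 2 by rewrite divr_gt0.
have [s0 s0_gt0 hs0] := cost_expansion hl3 d20.
(* For a minimum [- A < - (4 * M)], one application of [u_sub] raises the value by at most
   [A / 4 + A / 8 + A / 8], so that [u lam] stays below [- A / 2] everywhere. *)
pose lam1 := Num.min lam0 (8^-1 / (ku + kv + 1)).
have k_gt0 : 0 < ku + kv + 1 by lra.
exists lam1, (4 * M); split.
- by rewrite lt_min lam0_gt0 divr_gt0.
- by rewrite ge_min lexx.
- by rewrite mulr_ge0.
move=> lam x lam_gt0; rewrite lt_min => /andP[lam_lt lamk].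
have lamku : lam * ku <= 8^-1.
  move: lamk; rewrite ltr_pdivlMr//; have := mulr_ge0 (ltW lam_gt0) kv0.
  by nra.
have lamkv : lam * kv <= 8^-1.
  move: lamk; rewrite ltr_pdivlMr//; have := mulr_ge0 (ltW lam_gt0) ku0.
  by nra.
have [x0 x0min] := compact_min compactX point (continuous_u lam_gt0 lam_lt).
apply: le_trans (x0min x); rewrite leNgt; apply/negP => uM.
pose A := - u lam x0.
have A_gt : 4 * M < A by rewrite /A; lra.
have A0 : 0 < A by lra.
have lamA : lam * `|u lam x0| = lam * A by rewrite ltr0_norm// /A; lra.
have u_le y : u lam y <= - A / 2.
  have := u_sub lam_gt0 lam_lt x0 y; have := cM x0 y; rewrite ler_norml.
  have kuA : ku * (lam * A) <= 8^-1 * A.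
    by rewrite mulrA [ku * _]mulrC ler_wpM2r// ltW.
  have [uy|uy] := leP 0 (u lam y).
    have := le_cost hl2 x0 y (lexx (lam * u lam x0))
      (mulr_ge0 (ltW lam_gt0) uy).
    have := cost_lipschitz x0 y (lam * u lam x0) 0.
    rewrite normr0 mulr0 addr0 normrM gtr0_norm// lamA.
    by rewrite /A in A_gt kuA *; lra.
  have := cost_lipschitz x0 y (lam * u lam x0) (lam * u lam y).
  rewrite !normrM gtr0_norm// lamA [`|u lam y|]ltr0_norm//.
  have : kv * (lam * - u lam y) <= 8^-1 * A.
    rewrite mulrA [kv * _]mulrC; apply: ler_pM => //.
    - by rewrite mulr_ge0// ltW.
    - by rewrite oppr_ge0 ltW.
    - by rewrite /A lerN2.
  by rewrite /A in A_gt kuA *; lra.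
(* The last bound ensures [s * C <= 1]: the subsolution inequality of [w] is multiplied by
   [1 - s * C]. *)
pose s := Num.min (Num.min (lam * (A / 2)) s0) (C + 1)^-1.
have C1 : 0 < C + 1 by lra.
have s_gt0 : 0 < s by rewrite !lt_min s0_gt0 invr_gt0 C1 !mulr_gt0.
have s_le : s <= s0 by rewrite !ge_min lexx orbT.
have sC : s * C <= 1.
  have : s * (C + 1) <= 1 by rewrite -ler_pdivlMr// mul1r ge_min lexx orbT.
  by lra.
have s_lam z : lam * u lam z <= - s.
  have : s <= lam * (A / 2) by rewrite !ge_min lexx.
  have : lam * u lam z <= lam * (- A / 2) by rewrite ler_pM2l.
  by lra.
apply: (@no_strict_decrease (fun x => u lam x - s * g x - (1 - s * C) * w x)
  (s * (d / 2))); last 2 first.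
- by rewrite mulr_gt0.
- move=> y; have [z uz] := u_calibrated lam_gt0 lam_lt y; exists z.
  have := le_cost hl2 z y (s_lam z) (s_lam y).
  have := hs0 z y (- s) (- s) s.
  rewrite normrN gtr0_norm// lexx s_le => /(_ isT isT isT).
  have := ler_wpM2l (ltW s_gt0) (hg z y).
  have sC0 : 0 <= 1 - s * C by rewrite subr_ge0.
  have := ler_wpM2l sC0 (w_sub z y).
  rewrite ler_norml -uz => h0 h1 /andP[h2 _] h3.
  by lra.
- apply: contB; last exact: contZ.
  by apply: contB; [exact: continuous_u|exact: contZ].
Qed.

Lemma u_bounded : exists lam1 K, [/\ 0 < lam1, lam1 <= lam0, 0 <= K &
  forall lam x, 0 < lam -> lam < lam1 -> `|u lam x| <= K].
Proof.
have [lam1 [M [lam1_gt0 lam1_le M0 hM]]] := u_ge.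
have [N N0 cN] := pair_bounded cc.
exists lam1, (N + M); split=> //; first exact: addr_ge0.
move=> lam x lam_gt0 lam_lt; have := hM lam x lam_gt0 lam_lt.
have := u_le lam_gt0 (lt_le_trans lam_lt lam1_le) N0 cN x.
by rewrite ler_norml; lra.
Qed.

Lemma equicontinuous_u lam1 K y e : lam1 <= lam0 ->
  (forall lam x, 0 < lam -> lam < lam1 -> `|u lam x| <= K) -> 0 < e ->
  \forall x \near y, forall lam, 0 < lam -> lam < lam1 ->
    `|u lam x - u lam y| < e.
Proof.
move=> lam1_le hK e0.
pose J := `[- (lam1 * K), lam1 * K]%classic.
pose A : set (X * (R * R)) := setT `*` (J `*` J).
have cA : compact A.
  by apply: compact_setX => //; apply: compact_setX; exact: segment_compact.
pose F (p : X * (R * R)) x := l p.1 x p.2.1 p.2.2.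
have cF : continuous (fun q : (X * (R * R)) * X => F q.1 q.2).
  apply: (cont_cost continuous_l).
  - exact: (cont_comp cont_fst cont_fst).
  - exact: cont_snd.
  - exact: (cont_comp (cont_comp cont_fst cont_snd) cont_fst).
  - exact: (cont_comp (cont_comp cont_fst cont_snd) cont_snd).
have := compact_unif_near y cA cF e0; apply: filterS => x hx lam lam_gt0 lam_lt.
have lam_lt0 := lt_le_trans lam_lt lam1_le.
have Ju t : J (lam * u lam t).
  have := hK lam t lam_gt0 lam_lt; rewrite /J /= in_itv/= -ler_norml normrM.
  by rewrite gtr0_norm// => h; apply: ler_pM => //; exact: ltW.
(* Monotonicity in [v] removes the implicit dependence: when [u lam s] is the larger value,
   replacing it by [u lam t] in the last argument only raises the cost, and the two costs then
   differ in the second argument alone. *)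
have half s t z : u lam t - u lam z = l z t (lam * u lam z) (lam * u lam t) ->
    l z s (lam * u lam z) (lam * u lam t) -
    l z t (lam * u lam z) (lam * u lam t) < e -> u lam s - u lam t < e.
  move=> ut hst; have [st|st] := leP (u lam s) (u lam t); first by lra.
  have := u_sub lam_gt0 lam_lt0 z s.
  have lst : lam * u lam t <= lam * u lam s by rewrite ler_pM2l// ltW.
  by have := le_cost hl2 z s (lexx (lam * u lam z)) lst; lra.
have [z uz] := u_calibrated lam_gt0 lam_lt0 y.
have [z' uz'] := u_calibrated lam_gt0 lam_lt0 x.
rewrite ltr_norml; apply/andP; split.
  suff : u lam y - u lam x < e by lra.
  apply: (half _ _ _ uz').
  have := hx (z', (lam * u lam z', lam * u lam x))
    (conj I (conj (Ju _) (Ju _))).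
  by rewrite /F /= ltr_norml; lra.
apply: (half _ _ _ uz).
have := hx (z, (lam * u lam z, lam * u lam y)) (conj I (conj (Ju _) (Ju _))).
by rewrite /F /= ltr_norml; lra.
Qed.

Lemma near0_mul_le (k t : R) : 0 < t -> \forall lam \near 0^'+, lam * k <= t.
Proof.
move=> t0; have k1 : 0 < `|k| + 1 by rewrite ltr_wpDl.
near=> lam; have lam_gt0 : 0 < lam by [].
have : lam < t / (`|k| + 1).
  by near: lam; apply: nbhs_right_lt; rewrite divr_gt0.
rewrite ltr_pdivlMr// => h; apply: le_trans (ltW h).
by rewrite ler_wpM2l ?(ltW lam_gt0)//; have := ler_norm k; lra.
Unshelve. all: by end_near. Qed.

(* On an optimal pair (z, x) for u one has
   u x - u z = c z x - lam (a u z + b u x) + o(lam) with a, b = - du, - dv.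
   The term C1 (c z x) of the dual certificate of v is therefore a coboundary up
   to O(lam), absorbed in E, and the certificate of nondegeneracy turns into
   the weight 1 + lam (C u - g), with respect to which E is contracted. *)
Lemma u_ge_subsolution lam1 K (v : X -> R) e : 0 < lam1 -> lam1 <= lam0 ->
  0 <= K -> (forall lam x, 0 < lam -> lam < lam1 -> `|u lam x| <= K) ->
  continuous v -> S0 l v -> 0 < e ->
  \forall lam \near 0^'+, forall x, v x - e <= u lam x.
Proof.
move=> lam1_gt0 lam1_le K0 hK cv [v_sub v_int] e0.
have [d [C [g [d0 C0 cg hg]]]] := nondegenerate.
have [G G0 gG] := cont_bounded cg.
have [Bu Bu0 duB] := pair_bounded cdu.
have [Bv Bv0 dvB] := pair_bounded cdv.
pose B := Bu + Bv.
have B0 : 0 <= B by exact: addr_ge0.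
(* Chosen so that the final bound [f * d <= 2 * (e1 * (K + 2))] reads [f <= e / 4]. *)
pose e1 := e * d / (8 * (K + 2)).
have e1_gt0 : 0 < e1 by rewrite divr_gt0 ?mulr_gt0//; lra.
have e1E : e1 * (K + 2) = e * d / 8.
  by rewrite /e1; field; rewrite gt_eqF//; lra.
pose h (p : X * X) := - (du p.1 p.2 * v p.1 + dv p.1 p.2 * v p.2).
have ch' : continuous (fun p : X * X =>
    du p.1 p.2 * v p.1 + dv p.1 p.2 * v p.2).
  exact: (contD (contM cdu (cont_comp_fst cv)) (contM cdv (cont_comp_snd cv))).
have ch : continuous h by exact: contN.
have h_int mu : is_Mather_measure c mu -> \int[mu]_p h p <= 0.
  move=> muM; have := v_int mu muM.
  rewrite /h; under [X in _ -> X <= _]eq_Rintegral do rewrite -mulN1r.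
  by rewrite (intZ (compactXX compactX)); [lra|exact: ch'].
have [C1 [g1 [C10 cg1 hg1]]] := Mather_dominates_le compactX cc cont_w w_sub
  w_calibrated ch h_int e1_gt0.
have [G1 G10 g1G] := cont_bounded cg1.
have [s0 s0_gt0 hs0] := cost_expansion hl3 e1_gt0.
pose G2 := C1 * K + G1; pose Ga := C * K + G; pose k1 := 2 * B * K + e1 * K.
have G20 : 0 <= G2 by rewrite addr_ge0 ?mulr_ge0.
have Ga0 : 0 <= Ga by rewrite addr_ge0 ?mulr_ge0.
have d40 : 0 < d / 4 by rewrite divr_gt0.
have e20 : 0 < e / 2 by rewrite divr_gt0.
have h20 : 0 < 2^-1 :> R by rewrite invr_gt0.
near=> lam.
have lam_gt0 : 0 < lam by [].
have lam_lt : lam < lam1 by near: lam; exact: nbhs_right_lt.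
have lam_lt0 := lt_le_trans lam_lt lam1_le.
have S1 : lam * K <= s0 by near: lam; exact: near0_mul_le.
have S2 : lam * (C1 * k1 + 2 * B * G2) <= e1 by near: lam; exact: near0_mul_le.
have S3 : lam * (C * k1) <= d / 4 by near: lam; exact: near0_mul_le.
have S4 : lam * Ga <= 2^-1 by near: lam; exact: near0_mul_le.
have S4' : lam * B <= 1 by near: lam; exact: near0_mul_le.
have S5 : lam * (2 * B * Ga) <= d / 4 by near: lam; exact: near0_mul_le.
have S6 : lam * G2 <= e / 2 by near: lam; exact: near0_mul_le.
have uK x := hK lam x lam_gt0 lam_lt.
pose Gl y := C1 * u lam y - g1 y.
pose ga y := C * u lam y - g y.
have GlG y : `|Gl y| <= G2.
  apply: le_trans (ler_normB _ _) _; rewrite lerD// normrM (ger0_norm C10).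
  exact: ler_wpM2l.
have gaG y : `|ga y| <= Ga.
  apply: le_trans (ler_normB _ _) _; rewrite lerD// normrM (ger0_norm C0).
  exact: ler_wpM2l.
pose E y := v y - u lam y - lam * Gl y.
have lamga y : 2^-1 <= 1 + lam * ga y /\ 1 + lam * ga y <= 3 / 2.
  have : `|lam * ga y| <= 2^-1.
    rewrite normrM gtr0_norm//; apply: le_trans S4.
    by rewrite ler_pM2l.
  by rewrite ler_norml; lra.
have ga_gt0 y : 0 < 1 + lam * ga y by have := lamga y; lra.
have cu := continuous_u lam_gt0 lam_lt0.
have cga : continuous (fun y => 1 + lam * ga y).
  apply: contD; first exact: cont_cst.
  by apply: contZ; apply: contB => //; exact: contZ.
have cE : continuous E.
  apply: contB; first exact: contB.
  by apply: contZ; apply: contB => //; exact: contZ.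
have cphi : continuous (fun y => E y / (1 + lam * ga y)).
  move=> y; apply: cvgM; first exact: cE.
  by apply: cvgV; [rewrite gt_eqF|exact: cga].
have [x0 x0max] := compact_max compactX point cphi.
set f := E x0 / (1 + lam * ga x0) in x0max.
have E_le y : E y <= f * (1 + lam * ga y) by rewrite -ler_pdivrMr.
have E_x0 : E x0 = f * (1 + lam * ga x0) by rewrite /f divfK// gt_eqF.
(* The weight is at most [3 / 2], so [E <= e / 2]; the correction [lam * Gl] takes the other half of
   [e]. *)
suff fd : f <= e / 4.
  move=> x; have := E_le x; have := lamga x; have := GlG x.
  rewrite ler_norml => /andP[Gx1 Gx2] [l1 l2].
  have : f * (1 + lam * ga x) <= e / 2.
    have [f0|f0] := leP f 0.
      by apply: le_trans (ltW e20); rewrite mulr_le0_ge0// ltW.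
    apply: (@le_trans _ _ (f * (3 / 2))); first by rewrite ler_pM2l.
    by lra.
  have : lam * Gl x <= lam * G2 by rewrite ler_pM2l.
  by rewrite /E; lra.
rewrite leNgt; apply/negP => f_gt.
have f0 : 0 < f by apply: lt_trans f_gt; rewrite divr_gt0.
have [z uz] := u_calibrated lam_gt0 lam_lt0 x0.
have a0 : 0 <= - du z x0 by rewrite oppr_ge0 (du0_le0 hl2 hl3).
have b0 : 0 <= - dv z x0 by rewrite oppr_ge0 (dv0_le0 hl2 hl3).
have aB : - du z x0 <= B.
  by have := duB z x0; rewrite ler_norml /B; lra.
have bB : - dv z x0 <= B.
  by have := dvB z x0; rewrite ler_norml /B; lra.
have u_eq : `|u lam x0 - u lam z - c z x0 +
    lam * (- du z x0 * u lam z + - dv z x0 * u lam x0)| <= e1 * (lam * K).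
  have := hs0 z x0 (lam * u lam z) (lam * u lam x0) (lam * K).
  rewrite !normrM !(gtr0_norm lam_gt0) !ler_pM2l// !uK S1.
  move=> /(_ isT isT isT); rewrite -uz; congr (`|_| <= _); ring.
have h_le : - du z x0 * v z + - dv z x0 * v x0 <=
    e1 + C1 * c z x0 + g1 z - g1 x0.
  by have := hg1 z x0; rewrite /h /= add0r; lra.
have nd : - (- du z x0 + - dv z x0) <= - d + C * c z x0 + g z - g x0.
  by have := hg z x0; lra.
have step := discounted_difference lam_gt0 a0 b0 aB bB (uK z) (uK x0) u_eq
  C10 (v_sub z x0) h_le (GlG z) (GlG x0) S2.
(* Makes the factor of [E z] nonnegative, so that [E z] may be replaced by its upper bound
   [f * (1 + lam * ga z)]. *)
have lama : lam * - du z x0 <= 1.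
  by apply: le_trans S4'; rewrite ler_pM2l.
have step2 : (1 + lam * - dv z x0) * (f * (1 + lam * (C * u lam x0 - g x0))) <=
    (1 - lam * - du z x0) * (f * (1 + lam * (C * u lam z - g z)))
    + lam * (e1 * (K + 2)).
  rewrite -E_x0; apply: (le_trans step); rewrite lerD2r ler_wpM2l ?subr_ge0//.
  exact: E_le.
have := discounted_contraction lam_gt0 a0 b0 aB bB (uK z) (uK x0) u_eq
  C0 nd (gaG z) (gaG x0) S3 S5 (ltW f0) step2.
rewrite e1E => fd; have : e / 4 * d < f * d by rewrite ltr_pM2r.
by lra.
Unshelve. all: by end_near. Qed.

Lemma cost_lipschitz_ge z x p q : c z x - ku * `|p| - kv * `|q| <= l z x p q.
Proof.
have [_ _ hu hv] := hl1.
have := hu z x q (p, 0) (conj I I); have := hv z x 0 (q, 0) (conj I I).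
by rewrite /= !subr0 !ler_norml /cost0; lra.
Qed.

(** * Limit points along an ultrafilter finer than [0^'+] *)

Section UltraLimit.
Variables lam1 K : R.
Hypotheses (lam1_gt0 : 0 < lam1) (lam1_le : lam1 <= lam0) (K0 : 0 <= K).
Hypothesis uK : forall lam x, 0 < lam -> lam < lam1 -> `|u lam x| <= K.
Variable F : set_system R.
Hypothesis ultraF : UltraFilter F.
Hypothesis F0 : 0^'+ `<=` F.

Let near_F (P : set R) : (\forall lam \near 0^'+, P lam) ->
  \forall lam \near F, P lam.
Proof. exact: F0. Qed.

Let F_gt0 : \forall lam \near F, 0 < lam.
Proof. by apply: near_F; near=> lam. Unshelve. all: by end_near. Qed.

Let F_lt : \forall lam \near F, lam < lam1.
Proof. by apply: near_F; exact: nbhs_right_lt. Qed.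

Let F_proper : ProperFilter F.
Proof. exact: ultra_proper. Qed.

Let F_uK : \forall lam \near F, forall x, `|u lam x| <= K.
Proof.
by near=> lam => x; apply: uK; near: lam.
Unshelve. all: by end_near. Qed.

(** Compactness of [[-K, K]] gives a cluster point, and along an ultrafilter a cluster point is a
    limit. *)
Lemma pointwise_ultra_limit x : exists r, forall e, 0 < e ->
  \forall lam \near F, `|u lam x - r| < e.
Proof.
have mem : ((fun lam => u lam x) @ F) `[- K, K]%classic.
  have := F_uK; apply: filterS => lam /(_ x).
  by rewrite /= in_itv/= -ler_norml.
have [r [_ clr]] := @segment_compact R (- K) K _ _ mem.
exists r => e e0.
have [//|FC] := in_ultra_setVsetC [set lam | `|u lam x - r| < e] ultraF.
have FC' : ((fun lam => u lam x) @ F) [set s | ~ `|s - r| < e] by exact: FC.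
have [s [/= sr rs]] := clr _ _ FC' (nbhsx_ballx r e e0).
by exfalso; apply: sr; rewrite distrC.
Qed.

Lemma ultra_limit : exists ubar : X -> R,
  [/\ continuous ubar,
      forall e, 0 < e -> \forall lam \near F, forall x,
        `|u lam x - ubar x| < e &
      S0 l ubar].
Proof.
have [ubar hubar] := choice pointwise_ultra_limit.
have cubar : continuous ubar.
  apply/continuousP_lt => y e e0.
  have e30 : 0 < e / 3 by rewrite divr_gt0.
  have := equicontinuous_u y lam1_le uK e30; apply: filterS => x hx.
  near F => lam.
  have h1 : `|u lam x - ubar x| < e / 3 by near: lam; exact: hubar.
  have h2 : `|u lam y - ubar y| < e / 3 by near: lam; exact: hubar.
  have h3 : `|u lam x - u lam y| < e / 3 by apply: hx; near: lam.
  by move: h1 h2 h3; rewrite !ltr_norml; lra.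
have unif e : 0 < e -> \forall lam \near F, forall x, `|u lam x - ubar x| < e.
  move=> e0; have e30 : 0 < e / 3 by rewrite divr_gt0.
  have /compact_near_coveringP cov := compactX.
  suff : \forall lam \near F, [set: X] `<=` (fun x => `|u lam x - ubar x| < e).
    by apply: filterS => lam h x; exact: h.
  apply: cov => y _.
  have n1 := equicontinuous_u y lam1_le uK e30.
  have /continuousP_lt/(_ y _ e30) n2 := cubar.
  have n3 := hubar y _ e30.
  near=> x lam => /=.
  have h1 : `|u lam y - ubar y| < e / 3 by near: lam.
  have h2 : `|ubar x - ubar y| < e / 3 by near: x.
  have h3 : `|u lam x - u lam y| < e / 3.
    have hx : forall lam, 0 < lam -> lam < lam1 -> `|u lam x - u lam y| < e / 3.
      by near: x.
    by apply: hx; near: lam.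
  by move: h1 h2 h3; rewrite !ltr_norml; lra.
have [ku0 kv0 _ _] := hl1.
exists ubar; split=> //; split.
  move=> x y; apply/ler_addgt0Pr => e e0.
  have e30 : 0 < e / 3 by rewrite divr_gt0.
  near F => lam.
  have lam_gt0 : 0 < lam by near: lam.
  have lam_lt : lam < lam1 by near: lam.
  have h1 : `|u lam x - ubar x| < e / 3 by near: lam; exact: hubar.
  have h2 : `|u lam y - ubar y| < e / 3 by near: lam; exact: hubar.
  have h3 : lam * ((ku + kv) * K) <= e / 3.
    by near: lam; apply: near_F; exact: near0_mul_le.
  have := u_sub lam_gt0 (lt_le_trans lam_lt lam1_le) x y.
  have := cost_lipschitz x y (lam * u lam x) (lam * u lam y).
  rewrite !normrM !(gtr0_norm lam_gt0).
  have := ler_wpM2l ku0 (ler_wpM2l (ltW lam_gt0) (uK x lam_gt0 lam_lt)).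
  have := ler_wpM2l kv0 (ler_wpM2l (ltW lam_gt0) (uK y lam_gt0 lam_lt)).
  by move: h1 h2; rewrite !ltr_norml; lra.
move=> mu muM; have [mm mc] := muM.
have cXX := compactXX compactX.
have [B B0 duB] := pair_bounded cdu.
have [B' B'0 dvB] := pair_bounded cdv.
set I0 := Rintegral _ _ _.
(* The integral does not depend on [e], so letting [e] shrink excludes a negative value. *)
suff I_ge e : 0 < e -> - (e * (K + B + B')) <= I0.
  rewrite leNgt; apply/negP => I_lt.
  have k_gt0 : 0 < 2 * (K + B + B' + 1).
    rewrite mulr_gt0 ?ltr_wpDl ?addr_ge0 ?K0 ?B0 ?B'0//.
  have := I_ge (- I0 / (2 * (K + B + B' + 1))) _.
  rewrite divr_gt0 ?oppr_gt0// => /(_ isT).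
  have : - I0 / (2 * (K + B + B' + 1)) * (K + B + B') <= - I0 / 2.
    rewrite mulrAC ler_pdivrMr//.
    have : 0 <= - I0 * (K + B + B' + 1 - (K + B + B')).
      by rewrite mulr_ge0//; lra.
    by lra.
  by lra.
move=> e0; have [s0 s0_gt0 hs0] := cost_expansion hl3 e0.
near F => lam.
have lam_gt0 : 0 < lam by near: lam.
have lam_lt : lam < lam1 by near: lam.
have lam_lt0 := lt_le_trans lam_lt lam1_le.
have close : forall x, `|u lam x - ubar x| < e by near: lam; exact: unif.
have S1 : lam * K <= s0 by near: lam; apply: near_F; exact: near0_mul_le.
have cu := continuous_u lam_gt0 lam_lt0.
pose f (p : X * X) := du p.1 p.2 * ubar p.1 + dv p.1 p.2 * ubar p.2.
have cf : continuous f.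
  have cu1 := cont_comp_fst cubar; have cu2 := cont_comp_snd cubar.
  exact: (contD (contM cdu cu1) (contM cdv cu2)).
pose k := lam * (e * (K + B + B')).
have c1 := cont_comp_fst cu; have c2 := cont_comp_snd cu.
(* The integral of [g] is [- k]: the coboundary vanishes by equality of the marginals, and [c]
   integrates to 0. The terms of [k] are the expansion error and the cost of replacing [u lam] by
   [ubar] under [du] and [dv]. *)
pose g (p : X * X) := u lam p.2 - u lam p.1 - c p.1 p.2 - k.
have cg : continuous g.
  by apply: contB; [apply: contB => //; exact: contB|exact: cont_cst].
have fg p : g p <= lam * f p.
  case: p => z x; rewrite /g /f /=.
  have := u_sub lam_gt0 lam_lt0 z x.
  have := hs0 z x (lam * u lam z) (lam * u lam x) (lam * K).
  rewrite !normrM !(gtr0_norm lam_gt0) !ler_pM2l// !uK// S1.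
  move=> /(_ isT isT isT) /ler_normlP[_ h1] h2.
  have gap (r b s t : R) : `|r| <= b -> `|s - t| < e -> r * s <= r * t + b * e.
    move=> rb st; rewrite -lerBlDl -mulrBr.
    apply: le_trans (ler_norm _) _; rewrite normrM.
    by apply: ler_pM => //; exact: ltW.
  have h3 := gap _ _ _ _ (duB z x) (close z).
  have h4 := gap _ _ _ _ (dvB z x) (close x).
  have := ler_wpM2l (ltW lam_gt0) h3; have := ler_wpM2l (ltW lam_gt0) h4.
  by rewrite /k /=; lra.
have := le_int cXX mu cg (contZ cf) fg.
rewrite (intZ cXX mu _ cf) -/I0 /g.
have cuu := contB c2 c1.
rewrite (intB cXX mu (contB cuu cc) (@cont_cst _ _ _)) (intB cXX mu cuu cc).
rewrite (intB cXX mu c2 c1) (int_marginals compactX mm cu) int_cst mc /k.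
rewrite subrr sub0r oppr0 add0r => h.
have : lam * - (e * (K + B + B')) <= lam * I0 by lra.
by rewrite ler_pM2l.
Unshelve. all: by end_near. Qed.

Lemma ultra_limit_unique ubar w' : continuous ubar ->
  (forall e, 0 < e -> \forall lam \near F, forall x,
    `|u lam x - ubar x| < e) ->
  S0 l w' -> forall x, w' x <= ubar x.
Proof.
move=> cubar unif [w'_sub w'_int] x.
apply: (le_trans (subsolution_le_T0 w'_sub x)).
have cT := cont_T0 compactX cc w'_sub.
have ST : S0 l (T0 c w').
  split; first exact: T0_subsolution.
  move=> mu muM; have := w'_int mu muM.
  have [A [mA muA hA]] := T0_ae_eq compactX cc w'_sub muM.
  congr (0 <= _); apply: (Rintegral_eq_on mA muA) => p /hA[e1 e2].
  by rewrite -e1 -e2.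
apply/ler_addgt0Pr => e e0; have e20 : 0 < e / 2 by rewrite divr_gt0.
near F => lam.
have h1 : forall x, T0 c w' x - e / 2 <= u lam x.
  near: lam; apply: near_F.
  exact: (u_ge_subsolution lam1_gt0 lam1_le K0 uK cT ST e20).
have h2 : forall x, `|u lam x - ubar x| < e / 2 by near: lam; exact: unif.
by have := h1 x; have := h2 x; rewrite ltr_norml; lra.
Unshelve. all: by end_near. Qed.

(** The limit belongs to [S0 l] and dominates it, hence is its greatest element. This also shows
    that the [sup] defining [u0] is a genuine supremum, and that the limit is the same for every
    [F]. *)
Lemma ultra_limit_u0 :
  [/\ forall x, has_sup [set v x | v in S0 l], continuous (u0 l) &
      forall e, 0 < e -> \forall lam \near F, forall x,
        `|u lam x - u0 l x| < e].
Proof.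
have [ubar [cubar unif Subar]] := ultra_limit.
have le_ubar := ultra_limit_unique cubar unif.
have hs x : has_sup [set v x | v in S0 l].
  split; first by exists (ubar x), ubar.
  by exists (ubar x) => _ [v Sv <-]; exact: le_ubar.
have u0E : u0 l = ubar.
  apply/funext => x; apply/eqP; rewrite eq_le; apply/andP; split.
    apply: ge_sup; first by have [] := hs x.
    by move=> _ [v Sv <-]; exact: le_ubar.
  by apply: sup_upper_bound => //; exists ubar.
by rewrite u0E.
Qed.

End UltraLimit.

(** Were some closeness set [A] not a neighbourhood, the trace of [0^'+] on its complement would be
    proper and extend to an ultrafilter finer than [0^'+], which would contain both [A] and its
    complement. *)
Lemma u_cvg_u0 :
  [/\ forall x, has_sup [set v x | v in S0 l], continuous (u0 l) &
      forall e, 0 < e -> \forall lam \near 0^'+, forall x,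
        `|u lam x - u0 l x| < e].
Proof.
have [lam1 [K [lam1_gt0 lam1_le K0 uK]]] := u_bounded.
have limit F ultraF F0 :=
  @ultra_limit_u0 lam1 K lam1_gt0 lam1_le K0 uK F ultraF F0.
have [F [ultraF F0]] := ultraFilterLemma (at_right_proper_filter (0 : R)).
have [hs c0 _] := limit F ultraF F0.
split=> // e e0; pose A := [set lam | forall x, `|u lam x - u0 l x| < e].
apply: contrapT => nA.
have pA : ProperFilter (within (~` A) (0^'+ : set_system R)).
  split; last exact: within_filter.
  apply: contra_not nA; rewrite /within /=; apply: filterS => lam h.
  exact: contrapT.
have [G [ultraG AG]] := ultraFilterLemma pA.
have G0 : 0^'+ `<=` G by move=> P P0; apply: AG; apply: filterS P0.
have [_ _ /(_ e e0) GA] := limit G ultraG G0.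
have GC : G (~` A) by apply: AG; exact: withinT.
have : G (A `&` ~` A) by exact: filterI.
by rewrite setICr; exact: filter_not_empty.
Qed.

(** For the upper bound, the point [z] optimal for [u lam] at [x] is used at one small [lam], with a
    total error of at most [e]; no limit of optimal points is taken. *)
Lemma T0_u0 : T0 c (u0 l) = u0 l.
Proof.
have [lam1 [K [lam1_gt0 lam1_le K0 uK]]] := u_bounded.
have [hs c0 unif] := u_cvg_u0.
have [ku0 kv0 _ _] := hl1.
have u0_sub : is_subsolution c (u0 l).
  move=> x y; rewrite lerBlDl; apply: ge_sup; first by have [] := hs y.
  move=> _ [v Sv <-]; have [v_sub _] := Sv; have := v_sub x y.
  have : v x <= u0 l x by apply: sup_upper_bound => //; exists v.
  by lra.
apply/funext => x; apply/eqP; rewrite eq_le subsolution_le_T0// andbT.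
apply/ler_addgt0Pr => e e0; have e30 : 0 < e / 3 by rewrite divr_gt0.
near ((0 : R)^'+) => lam.
have lam_gt0 : 0 < lam by [].
have lam_lt : lam < lam1 by near: lam; exact: nbhs_right_lt.
have close : forall x, `|u lam x - u0 l x| < e / 3 by near: lam; exact: unif.
have h3 : lam * ((ku + kv) * K) <= e / 3 by near: lam; exact: near0_mul_le.
have [z uz] := u_calibrated lam_gt0 (lt_le_trans lam_lt lam1_le) x.
apply: (le_trans (T0_le u0_sub z x)).
have := cost_lipschitz_ge z x (lam * u lam z) (lam * u lam x).
rewrite -uz !normrM !(gtr0_norm lam_gt0).
have := ler_wpM2l ku0 (ler_wpM2l (ltW lam_gt0) (uK _ z lam_gt0 lam_lt)).
have := ler_wpM2l kv0 (ler_wpM2l (ltW lam_gt0) (uK _ x lam_gt0 lam_lt)).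
by have := close x; have := close z; rewrite !ltr_norml; lra.
Unshelve. all: by end_near. Qed.

End Discounted.

Theorem theorem4 (R : realType) (X : pmetricType R)
  (compactX : compact [set: X])
  (l : X -> X -> R -> R -> R)
  (continuous_l : continuous
    (fun p : (X * X) * (R * R) => l p.1.1 p.1.2 p.2.1 p.2.2))
  (ku kv : R)
  (hl1 : cond_l1 l ku kv) (hl2 : cond_l2 l) (hl3 : cond_l3 l) (hl4 : cond_l4 l)
  (critical0 : is_critical_constant (cost0 l) 0)
  (lam0 : R) (lam0_gt0 : 0 < lam0) (lam0_small : lam0 * Num.max ku kv < 1)
  (u : R -> X -> R)
  (continuous_u : forall lam, 0 < lam -> lam < lam0 -> continuous (u lam))
  (fixed_u : forall lam, 0 < lam -> lam < lam0 ->
    Tlambda l lam (u lam) = u lam) :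
  [/\ forall x, has_sup [set w x | w in S0 l],
      {uniform, u lam @[lam --> 0^'+] --> u0 l},
      continuous (u0 l) &
      T0 (cost0 l) (u0 l) = u0 l].
Proof.
have [w [cw w_sub w_cal]] := critical_solution compactX continuous_l critical0.
have u_fixed lam (lam_gt0 : 0 < lam) (lam_lt : lam < lam0) :=
  Tlambda_fixed compactX continuous_l hl2 (ltW lam_gt0)
    (continuous_u lam lam_gt0 lam_lt) (fixed_u lam lam_gt0 lam_lt).
have u_sub lam h1 h2 := (u_fixed lam h1 h2).1.
have u_cal lam h1 h2 := (u_fixed lam h1 h2).2.
have [hs c0 unif] := u_cvg_u0 compactX continuous_l hl1 hl2 hl3 hl4 cw w_sub
  w_cal lam0_gt0 lam0_small continuous_u u_sub u_cal.
split=> //; last first.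
  exact: (T0_u0 compactX continuous_l hl1 hl2 hl3 hl4 cw w_sub w_cal lam0_gt0
    lam0_small continuous_u u_sub u_cal).
move=> Q /= /uniform_nbhs[E [entE EQ]].
move: entE; rewrite -entourage_ballE => -[e /= e0 eE].
change (\forall lam \near 0^'+, Q (u lam)).
near=> lam; apply: EQ => /= x _; apply: eE; rewrite /= /ball/= distrC.
by have : forall x, `|u lam x - u0 l x| < e by near: lam; exact: unif.
Unshelve. all: by end_near. Qed.
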